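(* Fix $P\ge1$ and $\Omega=[B_-,B_+]$, and suppose one of the following holds: (i) $a,b$ are smooth real functions on $\Omega$ with $b>0$ and $c=b-a^2>0$; (ii) $a>0$, $b>0$ are constants with $c=b-a^2<0$. Let $u$ be a sufficiently smooth solution on $\Omega\times[0,T]$ of $$\partial_t(u_t-au_x)-\partial_x\big(a(u_t-au_x)+bu_x\big)=0,$$ with boundary conditions, in case (i), $u_t-\lambda_1u_x=0$ at $B_-$ and $u_t-\lambda_2u_x=0$ at $B_+$ (where $\lambda_1=a+\sqrt b$, $\lambda_2=a-\sqrt b$), and in case (ii), $u=0$ and $u_x=0$ at $B_+$. Partition $\Omega$ into $K\geq 2$ elements of equal length $\Delta x$, and let $\mathbf U(t)$ be the solution of the corresponding semi-discretisation (given in the context) with initial data $\mathbf U(0)$ and $\frac{d}{dt}\mathbf U(0)$ equal to the nodal values of $u(\cdot,0)$ and $u_t(\cdot,0)$. Let $\mathbf U_{ex}(t)$ be the vector of nodal values of $u(\cdot,t)$, $\mathbf E=\mathbf U_{ex}-\mathbf U$, and let $\delta$ be the energy-norm error $$\delta=\sqrt{\mathbf E_w^T\mathbf H\mathbf E_w+\mathbf E^TA\mathbf E},$$ where in case (i) $\mathbf E_w=\frac{d}{dt}\mathbf E$, $A=\widetilde{\mathbf D}^T\mathbf c\mathbf H\widetilde{\mathbf D}$, and in case (ii) $\mathbf E_w=\frac{d}{dt}\mathbf E-a\widehat{\mathbf D}\mathbf E$, $A=\widehat{\mathbf D}^Tb\mathbf H\widehat{\mathbf D}$. Then for each $t\in(0,T]$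 there is a constant $\widetilde C>0$, independent of $\Delta x$, such that $$\delta(t)\le\widetilde C\,\Delta x^{P-1}\int_0^t|u(\cdot,\tau)|_{H^{P+1}(\Omega)}\,d\tau .$$
   Context: Element operators: let $-1=\xi_1<\dots<\xi_{P+1}=1$ be the Gauss-Legendre-Lobatto nodes on $[-1,1]$ with positive weights $\omega_j$ (exact for polynomials of degree $\le 2P-1$), and $\phi_i$ the degree-$P$ Lagrange polynomials with $\phi_i(\xi_j)=\delta_{ij}$. Set $Q_{ij}=\sum_m\omega_m\phi_i(\xi_m)\phi_j'(\xi_m)$, $H_x=\frac{\Delta x}{2}\mathrm{diag}(\omega_1,\dots,\omega_{P+1})$, $D_x=H_x^{-1}Q$. Global operators: grid vectors in $\mathbb{R}^{K(P+1)}$ list the nodal values element by element (affine images of the $\xi_j$; interface nodes doubled). $\mathbf H$, $\mathbf D$ are block diagonal with $K$ blocks $H_x$, $D_x$. $\widehat{\mathbf B}$ is the matrix such that, for each interface between consecutive elements $k,k+1$, if $u^-$ is the last entry of $\mathbf U$ in element $k$ and $u^+$ the first entry in element $k+1$, both of the corresponding entries of $\widehat{\mathbf B}\mathbf U$ equal $u^--u^+$; all other entries of $\widehat{\mathbf B}\mathbf U$ are $0$. $\widetilde{\mathbf D}=\mathbf D-\frac12\mathbf H^{-1}\widehat{\mathbf B}$. $\mathbf e_1,\mathbf e_N$ are the first and last standard unit vectors of $\mathbb{R}^{K(P+1)}$, and $\widehat{\mathbf D}=\widetilde{\mathbf D}-\mathbf H^{-1}\mathbf e_N\mathbf e_N^T$.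 $\mathbf a,\mathbf b,\mathbf c,\boldsymbol\lambda_1,\boldsymbol\lambda_2$ are diagonal matrices of nodal values of $a,b,c,\lambda_1,\lambda_2$. Semi-discretisation, with $\mathbf G=\widetilde{\mathbf D}$ in case (i), $\mathbf G=\widehat{\mathbf D}$ in case (ii), and $\mathbf W=\frac{d}{dt}\mathbf U-\mathbf a\mathbf G\mathbf U$: $$\frac{d}{dt}\mathbf W-\mathbf D(\mathbf a\mathbf W+\mathbf b\mathbf D\mathbf U)+\tfrac12\mathbf H^{-1}\widehat{\mathbf B}(\mathbf a\mathbf W+\mathbf b\mathbf D\mathbf U)+\mathbf H^{-1}\big(-\tfrac12\mathbf D^T\mathbf b\widehat{\mathbf B}+\tfrac14\widehat{\mathbf B}^T\mathbf b\mathbf H^{-1}\widehat{\mathbf B}\big)\mathbf U=\mathbf R,$$ where in case (i) $$\mathbf R=\lambda_2(B_-)\mathbf H^{-1}\mathbf e_1\mathbf e_1^T\big(\tfrac{d}{dt}\mathbf U-\boldsymbol\lambda_1\mathbf D\mathbf U\big)-\lambda_1(B_+)\mathbf H^{-1}\mathbf e_N\mathbf e_N^T\big(\tfrac{d}{dt}\mathbf U-\boldsymbol\lambda_2\mathbf D\mathbf U\big),$$ and in case (ii) $$\mathbf R=-\mathbf H^{-1}\mathbf e_N\mathbf e_N^T\mathbf a\mathbf W-\mathbf H^{-1}\big(-\mathbf D^T\mathbf b\,\mathbf e_N\mathbf e_N^T+\mathbf e_N\mathbf e_N^T\mathbf b\mathbf H^{-1}\mathbf e_N\mathbf e_N^T\big)\mathbf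 U .$$ $|\cdot|_{H^{P+1}(\Omega)}$ denotes the Sobolev norm of order $P+1$ on $\Omega$. The dependence of $\widetilde C$ on quantities other than $\Delta x$ is not specified (it may depend on $P$, $a$, $b$, $t$ and $u$). *)

(* Defs.v *)
From HB Require Import structures.
From mathcomp Require Import all_boot all_order all_algebra.
From mathcomp Require Import all_classical all_reals all_analysis.
Import Order.TTheory GRing.Theory Num.Theory numFieldNormedType.Exports.

Set Implicit Arguments.
Unset Strict Implicit.
Unset Printing Implicit Defensive.

Local Open Scope classical_set_scope.
Local Open Scope ring_scope.

(* Derivatives relative to a set (in practice a closed interval), hence
   one-sided at the end points of the interval. *)
Definition diff_quot (R : realType) (f : R -> R) (x : R) : R -> R :=
  fun y => (f y - f x) / (y - x).

Definition derivable_on (R : realType) (S : set R) (f : R -> R) (x : R) : Prop :=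
  cvg (diff_quot f x @ within S x^').

Definition deriv_on (R : realType) (S : set R) (f : R -> R) (x : R) : R :=
  lim (diff_quot f x @ within S x^').

Fixpoint Ck_on (R : realType) (S : set R) (m : nat) (f : R -> R) : Prop :=
  {within S, continuous f} /\
  match m with
  | 0%N => True
  | m'.+1 => (forall x, S x -> derivable_on S f x) /\ Ck_on S m' (deriv_on S f)
  end.

Definition smooth_on (R : realType) (S : set R) (f : R -> R) : Prop :=
  forall m, Ck_on S m f.

(* Partial derivatives of u : (x, t) |-> u x t on the rectangle X `*` I. *)
Definition ddx (R : realType) (X : set R) (u : R -> R -> R) : R -> R -> R :=
  fun x t => deriv_on X (u^~ t) x.

Definition ddt (R : realType) (I : set R) (u : R -> R -> R) : R -> R -> R :=
  fun x t => deriv_on I (u x) t.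

Fixpoint Ck2_on (R : realType) (X I : set R) (m : nat) (u : R -> R -> R) : Prop :=
  {within X `*` I, continuous (fun z : R * R => u z.1 z.2)} /\
  match m with
  | 0%N => True
  | m'.+1 =>
      [/\ (forall x t, X x -> I t ->
             derivable_on X (u^~ t) x /\ derivable_on I (u x) t),
          Ck2_on X I m' (ddx X u) & Ck2_on X I m' (ddt I u)]
  end.

(* Full Sobolev norm of order k; it is only applied to functions of class C^k
   on the closed interval X, whose weak and classical derivatives coincide. *)
Definition sobolev_norm (R : realType) (X : set R) (k : nat) (v : R -> R) : R :=
  Num.sqrt (\sum_(j < k.+1)
    Rintegral lebesgue_measure X (fun x => (iter j (deriv_on X) v x) ^+ 2)).

(* Rodrigues' formula. *)
Definition legendre (R : realType) (n : nat) : {poly R} :=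
  (2 ^+ n * (n`!)%:R)^-1 *: (('X^2 - 1) ^+ n)^`(n).

Definition is_gll (R : realType) (P : nat) (xi w : 'I_P.+1 -> R) : Prop :=
  [/\ xi ord0 = -1 /\ xi ord_max = 1,
      (forall i j : 'I_P.+1, (i < j)%N -> xi i < xi j),
      (forall j : 'I_P.+1, j != ord0 -> j != ord_max ->
         root (legendre R P)^`() (xi j)),
      (forall j, 0 < w j) &
      (forall p : {poly R}, (size p <= 2 * P)%N ->
         \sum_j w j * p.[xi j]
         = Rintegral lebesgue_measure `[-1, 1] (fun x => p.[x]))].

Definition lagrange_poly (R : realType) (P : nat) (xi : 'I_P.+1 -> R)
    (i : 'I_P.+1) : {poly R} :=
  \prod_(j | j != i) ((xi i - xi j)^-1 *: ('X - (xi j)%:P)).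

Definition Qmx (R : realType) (P : nat) (xi w : 'I_P.+1 -> R) : 'M[R]_P.+1 :=
  \matrix_(i, j) \sum_m w m * (lagrange_poly xi i).[xi m]
                            * ((lagrange_poly xi j)^`()).[xi m].

Definition Hx (R : realType) (P : nat) (w : 'I_P.+1 -> R) (dx : R) : 'M[R]_P.+1 :=
  (dx / 2) *: diag_mx (\row_j w j).

Definition Dx (R : realType) (P : nat) (xi w : 'I_P.+1 -> R) (dx : R) :
    'M[R]_P.+1 :=
  invmx (Hx w dx) *m Qmx xi w.

(* Grid vectors have K blocks of P + 1 entries; entry j of block k is the row
   of index [tagnat.Rank k j]. *)
Notation gsize K P := (\sum_(k < K) P.+1)%N.

Definition delta_grid (R : realType) (K P : nat) (k : 'I_K) (j : 'I_P.+1) :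
    'cV[R]_(gsize K P) :=
  delta_mx (@tagnat.Rank K (fun=> P.+1) k j) 0.

Definition e_first (R : realType) (n : nat) : 'cV[R]_n :=
  \col_i (val i == 0%N)%:R.

Definition e_last (R : realType) (n : nat) : 'cV[R]_n :=
  \col_i ((val i).+1 == n)%:R.

Definition mesh_size (R : realType) (Bm Bp : R) (K : nat) : R := (Bp - Bm) / K%:R.

Definition node (R : realType) (P : nat) (xi : 'I_P.+1 -> R) (Bm Bp : R) (K : nat)
    (k : 'I_K) (j : 'I_P.+1) : R :=
  Bm + mesh_size Bm Bp K * (k%:R + (xi j + 1) / 2).

Definition nodal (R : realType) (P : nat) (xi : 'I_P.+1 -> R) (Bm Bp : R) (K : nat)
    (f : R -> R) : 'cV[R]_(gsize K P) :=
  \mxcol_(k < K) \col_(j < P.+1) f (node xi Bm Bp k j).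

Definition nodal_diag (R : realType) (P : nat) (xi : 'I_P.+1 -> R) (Bm Bp : R)
    (K : nat) (f : R -> R) : 'M[R]_(gsize K P) :=
  diag_mx (nodal xi Bm Bp K f)^T.

Definition Hg (R : realType) (P : nat) (w : 'I_P.+1 -> R) (Bm Bp : R) (K : nat) :
    'M[R]_(gsize K P) :=
  \mxdiag_(k < K) Hx w (mesh_size Bm Bp K).

Definition Dg (R : realType) (P : nat) (xi w : 'I_P.+1 -> R) (Bm Bp : R) (K : nat) :
    'M[R]_(gsize K P) :=
  \mxdiag_(k < K) Dx xi w (mesh_size Bm Bp K).

(* One rank-one term per interface k | k+1: it puts the jump u^- - u^+ on both
   rows attached to the interface. *)
Definition Bhat (R : realType) (K P : nat) : 'M[R]_(gsize K P) :=
  \sum_(k < K) \sum_(l < K | l == k.+1 :> nat)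
    (delta_grid R k (@ord_max P) + delta_grid R l ord0)
    *m (delta_grid R k (@ord_max P) - delta_grid R l ord0)^T.

Definition Dtilde (R : realType) (P : nat) (xi w : 'I_P.+1 -> R) (Bm Bp : R)
    (K : nat) : 'M[R]_(gsize K P) :=
  Dg xi w Bm Bp K - 2^-1 *: (invmx (Hg w Bm Bp K) *m Bhat R K P).

Definition Dhat (R : realType) (P : nat) (xi w : 'I_P.+1 -> R) (Bm Bp : R)
    (K : nat) : 'M[R]_(gsize K P) :=
  Dtilde xi w Bm Bp K
  - invmx (Hg w Bm Bp K) *m e_last R (gsize K P) *m (e_last R (gsize K P))^T.

(* Sign of c = b - a^2: [c_pos] has variable coefficients and one boundary
   condition at each end; [c_neg] has constant coefficients and two boundary
   conditions at the right end. *)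
Inductive regime := c_pos | c_neg.

Definition cfun (R : realType) (a b : R -> R) : R -> R := fun x => b x - a x ^+ 2.
Definition lambda1 (R : realType) (a b : R -> R) : R -> R :=
  fun x => a x + Num.sqrt (b x).
Definition lambda2 (R : realType) (a b : R -> R) : R -> R :=
  fun x => a x - Num.sqrt (b x).

Definition coeff_hyp (R : realType) (rg : regime) (X : set R) (a b : R -> R) :
    Prop :=
  match rg with
  | c_pos => [/\ smooth_on X a, smooth_on X b &
                forall x, X x -> 0 < b x /\ 0 < cfun a b x]
  | c_neg => exists a0 b0 : R,
      [/\ 0 < a0, 0 < b0, b0 - a0 ^+ 2 < 0 &
          forall x, X x -> a x = a0 /\ b x = b0]
  end.

Definition pde_solution (R : realType) (X I : set R) (a b : R -> R)
    (u : R -> R -> R) : Prop :=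
  let w := fun x t => ddt I u x t - a x * ddx X u x t in
  forall x t, X x -> I t ->
    ddt I w x t - ddx X (fun y s => a y * w y s + b y * ddx X u y s) x t = 0.

Definition boundary_cond (R : realType) (rg : regime) (Bm Bp : R) (I : set R)
    (a b : R -> R) (u : R -> R -> R) : Prop :=
  let X := `[Bm, Bp]%classic in
  forall t, I t ->
  match rg with
  | c_pos => ddt I u Bm t - lambda1 a b Bm * ddx X u Bm t = 0 /\
             ddt I u Bp t - lambda2 a b Bp * ddx X u Bp t = 0
  | c_neg => u Bp t = 0 /\ ddx X u Bp t = 0
  end.

(* Entrywise time derivative of a vector-valued function. *)
Definition vderivable_on (R : realType) (n : nat) (I : set R) (V : R -> 'cV[R]_n)
    (t : R) : Prop :=
  forall i, derivable_on I (fun s => V s i 0) t.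

Definition vderiv_on (R : realType) (n : nat) (I : set R) (V : R -> 'cV[R]_n)
    (t : R) : 'cV[R]_n :=
  \col_i deriv_on I (fun s => V s i 0) t.

Definition Gmx (R : realType) (rg : regime) (P : nat) (xi w : 'I_P.+1 -> R)
    (Bm Bp : R) (K : nat) : 'M[R]_(gsize K P) :=
  match rg with
  | c_pos => Dtilde xi w Bm Bp K
  | c_neg => Dhat xi w Bm Bp K
  end.

Definition Wvec (R : realType) (rg : regime) (P : nat) (xi w : 'I_P.+1 -> R)
    (Bm Bp : R) (K : nat) (I : set R) (a : R -> R)
    (U : R -> 'cV[R]_(gsize K P)) (t : R) : 'cV[R]_(gsize K P) :=
  vderiv_on I U t
  - nodal_diag xi Bm Bp K a *m Gmx rg xi w Bm Bp K *m U t.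

Definition Rvec (R : realType) (rg : regime) (P : nat) (xi w : 'I_P.+1 -> R)
    (Bm Bp : R) (K : nat) (I : set R) (a b : R -> R)
    (U : R -> 'cV[R]_(gsize K P)) (t : R) : 'cV[R]_(gsize K P) :=
  let Hi := invmx (Hg w Bm Bp K) in
  let D := Dg xi w Bm Bp K in
  let e1 := e_first R (gsize K P) in
  let eN := e_last R (gsize K P) in
  let am := nodal_diag xi Bm Bp K a in
  let bm := nodal_diag xi Bm Bp K b in
  let l1m := nodal_diag xi Bm Bp K (lambda1 a b) in
  let l2m := nodal_diag xi Bm Bp K (lambda2 a b) in
  match rg with
  | c_pos =>
      lambda2 a b Bm *:
        (Hi *m e1 *m e1^T *m (vderiv_on I U t - l1m *m D *m U t))
      - lambda1 a b Bp *:
        (Hi *m eN *m eN^T *m (vderiv_on I U t - l2m *m D *m U t))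
  | c_neg =>
      - (Hi *m eN *m eN^T *m am *m Wvec rg xi w Bm Bp I a U t)
      - Hi *m (- (D^T *m bm *m eN *m eN^T)
               + eN *m eN^T *m bm *m Hi *m eN *m eN^T) *m U t
  end.

Definition semidiscrete_eq (R : realType) (rg : regime) (P : nat)
    (xi w : 'I_P.+1 -> R) (Bm Bp : R) (K : nat) (I : set R) (a b : R -> R)
    (U : R -> 'cV[R]_(gsize K P)) (t : R) : Prop :=
  let Hi := invmx (Hg w Bm Bp K) in
  let D := Dg xi w Bm Bp K in
  let B := Bhat R K P in
  let am := nodal_diag xi Bm Bp K a in
  let bm := nodal_diag xi Bm Bp K b in
  let W := Wvec rg xi w Bm Bp I a U in
  let F := am *m W t + bm *m D *m U t in
  vderiv_on I W t - D *m F + 2^-1 *: (Hi *m B *m F)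
  + Hi *m (- (2^-1 *: (D^T *m bm *m B))
           + 4^-1 *: (B^T *m bm *m Hi *m B)) *m U t
  = Rvec rg xi w Bm Bp I a b U t.

Definition semidiscrete_solution (R : realType) (rg : regime) (P : nat)
    (xi w : 'I_P.+1 -> R) (Bm Bp T : R) (K : nat) (a b : R -> R)
    (u : R -> R -> R) (U : R -> 'cV[R]_(gsize K P)) : Prop :=
  let I := `[0, T]%classic in
  [/\ U 0 = nodal xi Bm Bp K (u^~ 0),
      vderiv_on I U 0 = nodal xi Bm Bp K ((ddt I u)^~ 0),
      (forall t, I t ->
         vderivable_on I U t /\
         vderivable_on I (Wvec rg xi w Bm Bp I a U) t) &
      forall t, I t -> semidiscrete_eq rg xi w Bm Bp I a b U t].

Definition energy_error (R : realType) (rg : regime) (P : nat)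
    (xi w : 'I_P.+1 -> R) (Bm Bp T : R) (K : nat) (a b : R -> R)
    (u : R -> R -> R) (U : R -> 'cV[R]_(gsize K P)) (t : R) : R :=
  let I := `[0, T]%classic in
  let H := Hg w Bm Bp K in
  let Dt := Dtilde xi w Bm Bp K in
  let Dh := Dhat xi w Bm Bp K in
  let E := fun s => nodal xi Bm Bp K (u^~ s) - U s in
  let Ew := match rg with
    | c_pos => vderiv_on I E t
    | c_neg => vderiv_on I E t - nodal_diag xi Bm Bp K a *m Dh *m E t
    end in
  let A := match rg with
    | c_pos => Dt^T *m nodal_diag xi Bm Bp K (cfun a b) *m H *m Dt
    | c_neg => Dh^T *m nodal_diag xi Bm Bp K b *m H *m Dh
    end in
  Num.sqrt ((Ew^T *m H *m Ew) 0 0 + ((E t)^T *m A *m E t) 0 0).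

(* Main.v *)
(** The local operators satisfy summation by parts because the Lobatto quadrature
    is exact on derivatives of products of two Lagrange polynomials; summed over
    the elements, the interface terms telescope and
    [<x, Dt y> + <Dt x, y> = x_N y_N - x_1 y_1] for the product [<,>] weighted by
    [H], where [Dt] is the interface-corrected operator.  Testing the scheme with
    the energy velocity ([dU/dt] or [W]) then shows that the energy of any
    perturbation grows at most like its product with the residual.

    The residual of the exact solution is a linear combination of differentiation
    errors of size [dx ^ P], at worst divided once more by [dx]: the interface jumps
    of [u], [u_t] and of the flux vanish, and the boundary conditions cancel the
    boundary terms up to such an error.  This yields [C * dx ^ P.-1] for the error,
    with a constant that may absorb the time integral of the Sobolev norm when that
    integral is positive.  When it is zero, [u] vanishes up to time [t], the
    residual is zero and so is the error. *)

Require Import Defs.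
From HB Require Import structures.
From mathcomp Require Import all_boot all_order all_algebra.
From mathcomp Require Import all_classical all_reals all_analysis.
From mathcomp Require Import ring lra zify.
Import Order.TTheory GRing.Theory Num.Theory numFieldNormedType.Exports.
Local Open Scope classical_set_scope.
Local Open Scope ring_scope.

Set Implicit Arguments.
Unset Strict Implicit.
Unset Printing Implicit Defensive.

(** * Derivatives relative to a set *)

(** The comparison is with the nodal values of [u] itself, not with an interpolant, so the error and
    its time derivative start at exactly zero and the residual is the only source of error. The loss
    from [dx ^ P] to [dx ^ P.-1] has one origin: the discrete flux contains [D U] where the exact
    one contains [u_x], and this discrepancy of size [dx ^ P] is differentiated once more, or
    divided by a quadrature weight at the boundary. All other errors keep the full power. The
    residual is estimated in the maximum norm, with constants of the reference element; this passes
    to the [H]-norm because the total weight of the grid does not depend on the number of elements.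
    The sign of [c] selects the test vector. For [c > 0], [dU/dt] makes the terms in [a] combine
    with [b] into the weight [c]. For [c < 0] both characteristics travel to the left, so [W] is the
    natural unknown, the left end is pure outflow, and [b < a ^ 2] is what makes the outflow form
    definite. *)

Section OneVariable.
Variable R : realType.
Implicit Types (S : set R) (f g : R -> R) (a b x y l : R).

(** The relational form obeys the rules of calculus without any uniqueness of limits; that is needed
    only to return to [deriv_on]. *)
Definition is_deriv_on S f x l : Prop := diff_quot f x @ within S x^' --> l.

(** There is room to the right of the point, or to its left when it is the end point [b]. Limits,
    hence relative derivatives, are therefore unique on a nondegenerate interval. *)
Lemma within_itv_proper a b x : a < b -> `[a, b]%classic x ->
  ProperFilter (within `[a, b] x^').
Proof.
move=> ab /=; rewrite in_itv /= => /andP[ax xb].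
apply: Build_ProperFilter_ex => P [e /= e0 eP].
have [xb'|xb'] := ltP x b.
  exists (x + Num.min (e / 2) (b - x)).
  have m0 : 0 < Num.min (e / 2) (b - x) by rewrite lt_min; apply/andP; split; lra.
  have m1 : Num.min (e / 2) (b - x) <= e / 2 by rewrite ge_min lexx.
  have m2 : Num.min (e / 2) (b - x) <= b - x by rewrite ge_min lexx orbT.
  apply: eP => /=.
  - by rewrite opprD addNKr normrN gtr0_norm//; lra.
  - by apply/eqP; lra.
  - by rewrite in_itv /=; apply/andP; split; lra.
exists (x - Num.min (e / 2) (x - a)).
have m0 : 0 < Num.min (e / 2) (x - a) by rewrite lt_min; apply/andP; split; lra.
have m1 : Num.min (e / 2) (x - a) <= e / 2 by rewrite ge_min lexx.
have m2 : Num.min (e / 2) (x - a) <= x - a by rewrite ge_min lexx orbT.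
apply: eP => /=.
- by rewrite opprB addrC subrK gtr0_norm//; lra.
- by apply/eqP; lra.
- by rewrite in_itv /=; apply/andP; split; lra.
Qed.

Lemma derivable_onP S f x : derivable_on S f x -> is_deriv_on S f x (deriv_on S f x).
Proof. by []. Qed.

Lemma is_deriv_on_derivable S f x l : is_deriv_on S f x l -> derivable_on S f x.
Proof. by move=> fl; apply/cvg_ex; exists l. Qed.

Lemma is_deriv_onE S f x l : ProperFilter (within S x^') ->
  is_deriv_on S f x l -> deriv_on S f x = l.
Proof. by move=> ? fl; apply/cvg_lim. Qed.

Lemma is_deriv_on_itvE a b f x l : a < b -> `[a, b]%classic x ->
  is_deriv_on `[a, b] f x l -> deriv_on `[a, b] f x = l.
Proof. by move=> ab /(within_itv_proper ab); exact: is_deriv_onE. Qed.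

Lemma cvg_within_dnbhs_eq S x l (h k : R -> R) :
  (forall y, y != x -> S y -> h y = k y) ->
  h @ within S x^' --> l -> k @ within S x^' --> l.
Proof.
move=> hk; apply: cvg_trans; apply: near_eq_cvg.
rewrite near_withinE; near=> y => Sy; apply: hk => //.
near: y; exact: nbhs_dnbhs_neq.
Unshelve. all: by end_near. Qed.

Lemma is_deriv_on_ext S f g x l : S x -> (forall y, S y -> f y = g y) ->
  is_deriv_on S f x l -> is_deriv_on S g x l.
Proof.
move=> Sx fg; apply: cvg_within_dnbhs_eq => y _ Sy.
by rewrite /diff_quot !fg.
Qed.

Lemma is_deriv_on_sub S S' f x l : S' `<=` S ->
  is_deriv_on S f x l -> is_deriv_on S' f x l.
Proof.
move=> SS'; apply: cvg_trans; apply: cvg_app; exact: within_subset.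
Qed.

Lemma is_deriv_on_cst S x l : is_deriv_on S (fun=> l) x 0.
Proof.
rewrite /is_deriv_on /diff_quot subrr.
under eq_fun do rewrite mul0r.
exact: cvg_cst.
Qed.

Lemma is_deriv_on_id S x : is_deriv_on S id x 1.
Proof.
apply: (@cvg_within_dnbhs_eq _ _ _ (fun=> 1)); last exact: cvg_cst.
by move=> y xy _; rewrite /diff_quot divff// subr_eq0.
Qed.

Lemma is_deriv_onD S f g x l m : is_deriv_on S f x l -> is_deriv_on S g x m ->
  is_deriv_on S (fun y => f y + g y) x (l + m).
Proof.
move=> fl gm; apply: cvg_within_dnbhs_eq (cvgD fl gm) => y _ _.
by rewrite ?fctE /diff_quot /=; ring.
Qed.

Lemma is_deriv_onZ k S f x l : is_deriv_on S f x l ->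
  is_deriv_on S (fun y => k * f y) x (k * l).
Proof.
move=> fl; apply: cvg_within_dnbhs_eq (cvgM (cvg_cst k) fl) => y _ _.
by rewrite ?fctE /diff_quot /=; ring.
Qed.

Lemma is_deriv_onN S f x l : is_deriv_on S f x l ->
  is_deriv_on S (fun y => - f y) x (- l).
Proof.
move=> fl; have := @is_deriv_onZ (-1) S f x l fl; rewrite mulN1r.
by under eq_fun do rewrite mulN1r.
Qed.

Lemma is_deriv_onB S f g x l m : is_deriv_on S f x l -> is_deriv_on S g x m ->
  is_deriv_on S (fun y => f y - g y) x (l - m).
Proof. by move=> fl gm; apply: is_deriv_onD => //; exact: is_deriv_onN. Qed.

Lemma is_deriv_on_sum S (I : Type) (r : seq I) (F : I -> R -> R) (L : I -> R) x :
  (forall i, is_deriv_on S (F i) x (L i)) ->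
  is_deriv_on S (fun y => \sum_(i <- r) F i y) x (\sum_(i <- r) L i).
Proof.
move=> FL; elim: r => [|i r IH].
  rewrite big_nil; under eq_fun do rewrite big_nil.
  exact: is_deriv_on_cst.
rewrite big_cons; under eq_fun do rewrite big_cons.
exact: is_deriv_onD.
Qed.

Lemma is_deriv_on_cvg' S f x l : is_deriv_on S f x l ->
  f @ within S x^' --> f x.
Proof.
move=> fl.
have id0 : (fun y : R => y - x) @ within S x^' --> (0 : R).
  rewrite -(subrr x); apply: cvgB; last exact: cvg_cst.
  by move=> A /= xA; apply: cvg_within; apply: nbhs_dnbhs.
have := cvgD (cvg_cst (f x)) (cvgM fl id0); rewrite mulr0 addr0.
move=> h.
(* Away from [x], the value [f y] is [f x] plus the difference quotient times [y - x]. *)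
apply: (@cvg_within_dnbhs_eq S x (f x) (fun y => f x + diff_quot f x y * (y - x))); last exact: h.
move=> y xy _.
by rewrite ?fctE /diff_quot divfK ?subr_eq0// addrC subrK.
Qed.

Lemma is_deriv_on_cvg S f x l : is_deriv_on S f x l ->
  f @ within S (nbhs x) --> f x.
Proof.
move=> /is_deriv_on_cvg' fl A fA; have := fl A fA.
rewrite /within /= !nbhs_simpl /= /dnbhs /within /= => h.
rewrite nbhsE /= in h *; have [B xB BA] := h; exists B => // y By Sy.
have [->|xy] := eqVneq y x; first exact: nbhs_singleton.
exact: BA.
Qed.

Lemma is_deriv_on_cont S f (df : R -> R) :
  (forall x, S x -> is_deriv_on S f x (df x)) -> {within S, continuous f}.
Proof.
move=> h; apply/subspace_continuousP => x Sx.
exact: is_deriv_on_cvg (h _ Sx).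
Qed.

Lemma is_deriv_onM S f g x l m : is_deriv_on S f x l -> is_deriv_on S g x m ->
  is_deriv_on S (fun y => f y * g y) x (l * g x + f x * m).
Proof.
move=> fl gm; have gc := is_deriv_on_cvg' gm.
apply: cvg_within_dnbhs_eq (cvgD (cvgM fl gc) (cvgM (cvg_cst (f x)) gm)) => y _ _.
by rewrite ?fctE /diff_quot /=; ring.
Qed.

(** Near an interior point the restriction to the interval is void; this gives access to the mean
    value theorem for ordinary derivatives. *)
Lemma is_deriv_on_interior a b f x l : x \in `]a, b[%R ->
  is_deriv_on `[a, b] f x l -> is_derive x 1 f l.
Proof.
rewrite in_itv /= => /andP[ax xb] fl.
have fl' : diff_quot f x @ x^' --> l.
  move=> A lA; have := fl A lA; rewrite /= !nbhs_simpl /=.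
  rewrite /within /= => h; near=> y.
  have : y \in `[a, b]%R -> A (diff_quot f x y) by near: y; exact: h.
  apply; rewrite in_itv /=; apply/andP; split; near: y; apply: nbhs_dnbhs.
    by near=> y; apply: ltW; near: y; exact: lt_nbhsr.
  by near=> y; apply: ltW; near: y; exact: lt_nbhsl.
have fl2 : (fun h => h^-1 *: ((f \o shift x) (h *: (1 : R)) - f x)) @ 0^' --> l.
  move=> A lA; have := fl' A lA => /=; rewrite !nbhs_simpl /=.
  move=> [e /= e0 eA]; exists e => //= h /= h0 hn.
  have := eA (h + x); rewrite /= /diff_quot addrK.
  rewrite [_ / h]mulrC /shift /= [h *: 1]mulr1; apply.
    by rewrite opprD addrCA subrr addr0 normrN; move: h0; rewrite sub0r normrN.
  by apply: contra_neq hn => /eqP; rewrite -subr_eq0 addrK => /eqP.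
apply: DeriveDef; first by apply/cvg_ex; exists l.
by apply/cvg_lim.
Unshelve. all: by end_near. Qed.

Lemma MVT_on a b f (df : R -> R) x y :
  (forall z, `[a, b]%classic z -> is_deriv_on `[a, b] f z (df z)) ->
  a <= x -> x <= y -> y <= b ->
  exists2 z, x <= z <= y & f y - f x = df z * (y - x).
Proof.
move=> h ax xy yb.
have sub : `[x, y]%classic `<=` `[a, b]%classic.
  by move=> z /=; rewrite !in_itv /= => /andP[? ?]; apply/andP; split; lra.
have hd z : z \in `]x, y[%R -> is_derive z 1 f (df z).
  (* Restricting to [[x, y]], of which [z] is an interior point, avoids any case on the end points
     of [[a, b]]. *)
  move=> zxy; apply: (@is_deriv_on_interior x y) => //.
  apply: (is_deriv_on_sub sub); apply: h; apply: sub => /=.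
  by move: zxy; rewrite !in_itv /= => /andP[? ?]; apply/andP; split; lra.
have hc : {within `[x, y], continuous f}.
  exact: (continuous_subspaceW sub (is_deriv_on_cont h)).
have [c] := MVT_segment xy hd hc.
by rewrite in_itv /=; exists c.
Qed.

(** The derivative is bounded only at points no farther from [x] than [y], so [M] may depend on that
    distance, as it does in Taylor's formula. *)
Lemma MVT_abs_le a b f (df : R -> R) x y M :
  (forall z, `[a, b]%classic z -> is_deriv_on `[a, b] f z (df z)) ->
  `[a, b]%classic x -> `[a, b]%classic y ->
  (forall z, `|z - x| <= `|y - x| -> `[a, b]%classic z -> `|df z| <= M) ->
  `|f y - f x| <= M * `|y - x|.
Proof.
move=> h /=; rewrite !in_itv /= => /andP[ax xb] /andP[ay yb] hM.
have [xy|yx] := leP x y.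
  have [z /andP[xz zy] ->] := MVT_on h ax xy yb.
  rewrite normrM ler_wpM2r// hM//.
    by rewrite !ger0_norm ?subr_ge0//; lra.
  by rewrite in_itv /=; apply/andP; split; lra.
have [z /andP[xz zy]] := MVT_on h ay (ltW yx) xb.
rewrite distrC [`|y - x|]distrC => ->.
rewrite normrM ler_wpM2r// hM//.
  by rewrite !ler0_norm ?subr_le0//; lra.
by rewrite in_itv /=; apply/andP; split; lra.
Qed.

End OneVariable.

(** * Uniformly bounded derivatives and Taylor polynomials *)

Section BoundedDerivatives.
Variable R : realType.
Variables al be : R.
Hypothesis ab : al < be.
Let X : set R := `[al, be]%classic.
Implicit Types (f g : R -> R) (x y l M N : R) (n : nat).

(** A quantitative substitute for class [C^n]: one bound [M] for all derivatives, which can be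
    shared by all time slices of a function of two variables. *)
Fixpoint bounded_Ck (S : set R) n M f : Prop :=
  (forall x, S x -> `|f x| <= M) /\
  match n with
  | 0%N => True
  | n'.+1 => (forall x, S x -> derivable_on S f x) /\ bounded_Ck S n' M (deriv_on S f)
  end.

Lemma bounded_Ck_ext n M f g : (forall x, X x -> f x = g x) ->
  bounded_Ck X n M f -> bounded_Ck X n M g.
Proof.
elim: n f g => [|n IH] f g fg /= [fM].
  by split => // x Xx; rewrite -fg//; exact: fM.
move=> [fd fC].
have gd x : X x -> is_deriv_on X g x (deriv_on X f x).
  by move=> Xx; apply: is_deriv_on_ext fg _ => //; apply: derivable_onP; exact: fd.
split; first by move=> x Xx; rewrite -fg//; exact: fM.
split; first by move=> x /gd /is_deriv_on_derivable.
apply: IH fC => x Xx.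
by rewrite (is_deriv_on_itvE ab Xx (gd x Xx)).
Qed.

Lemma bounded_Ck_le n M N f : M <= N -> bounded_Ck X n M f -> bounded_Ck X n N f.
Proof.
move=> MN; elim: n f => [|n IH] f /= [fM].
  by split => // x Xx; apply: le_trans MN; exact: fM.
move=> [fd fC]; split; last by split => //; exact: IH.
by move=> x Xx; apply: le_trans MN; exact: fM.
Qed.

Lemma bounded_Ck_leq m n M f : (m <= n)%N -> bounded_Ck X n M f -> bounded_Ck X m M f.
Proof.
elim: n m f => [|n IH] [|m] f //=; first by move=> _ [fM _]; split.
by rewrite ltnS => mn [fM [fd fC]]; split => //; split => //; exact: IH.
Qed.

Lemma bounded_Ck_sup n M f x : bounded_Ck X n M f -> X x -> `|f x| <= M.
Proof. by case: n => [|n] /= [fM _]; exact: fM. Qed.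

Lemma bounded_Ck_cst n (k : R) : bounded_Ck X n `|k| (fun=> k).
Proof.
elim: n k => [|n IH] k /=; first by split.
split; first by move=> x _.
split; first by move=> x _; apply: is_deriv_on_derivable (is_deriv_on_cst X x k).
apply: (@bounded_Ck_le n `|0|); first by rewrite normr0.
apply: bounded_Ck_ext (IH 0) => x Xx.
by rewrite (is_deriv_on_itvE ab Xx (@is_deriv_on_cst _ X x k)).
Qed.

Lemma bounded_CkD n M N f g : bounded_Ck X n M f -> bounded_Ck X n N g ->
  bounded_Ck X n (M + N) (fun x => f x + g x).
Proof.
elim: n f g => [|n IH] f g /= [fM fC] [gN gC].
  split => // x Xx; apply: le_trans (ler_normD _ _) _; apply: lerD.
    exact: fM.
  exact: gN.
case: fC => fd fC; case: gC => gd gC.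
have D x : X x ->
    is_deriv_on X (fun x => f x + g x) x (deriv_on X f x + deriv_on X g x).
  by move=> Xx; apply: is_deriv_onD; apply: derivable_onP; [exact: fd|exact: gd].
split.
  move=> x Xx; apply: le_trans (ler_normD _ _) _; apply: lerD.
    exact: fM.
  exact: gN.
split; first by move=> x /D /is_deriv_on_derivable.
apply: bounded_Ck_ext (IH _ _ fC gC) => x Xx.
by rewrite (is_deriv_on_itvE ab Xx (D x Xx)).
Qed.

(** Each use of the product rule doubles the number of terms, whence the factor [2 ^+ n]. *)
Lemma bounded_CkM n M N f g : bounded_Ck X n M f -> bounded_Ck X n N g ->
  bounded_Ck X n (2 ^+ n * (M * N)) (fun x => f x * g x).
Proof.
have X0 : X al by rewrite /X /= in_itv /= lexx ltW.
have bnd f' g' m M' N' : bounded_Ck X m M' f' -> bounded_Ck X m N' g' ->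
    forall x, X x -> `|f' x * g' x| <= 2 ^+ m * (M' * N').
  move=> fC gC x Xx; rewrite normrM.
  have fM := bounded_Ck_sup fC Xx; have gN := bounded_Ck_sup gC Xx.
  apply: (@le_trans _ _ (M' * N')); first exact: ler_pM.
  rewrite ler_peMl ?exprn_ege1// ?ler1n// mulr_ge0//.
    exact: le_trans fM.
  exact: le_trans gN.
elim: n f g => [|n IH] f g fC gC; first by split => //; exact: bnd fC gC.
split; first exact: bnd fC gC.
have fC' : bounded_Ck X n M f by exact: bounded_Ck_leq fC.
have gC' : bounded_Ck X n N g by exact: bounded_Ck_leq gC.
case: fC => fM [fd fC]; case: gC => gN [gd gC].
have D x : X x -> is_deriv_on X (fun x => f x * g x) x
    (deriv_on X f x * g x + f x * deriv_on X g x).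
  by move=> Xx; apply: is_deriv_onM; apply: derivable_onP; [exact: fd|exact: gd].
split; first by move=> x /D /is_deriv_on_derivable.
apply: bounded_Ck_ext; last first.
  apply: bounded_Ck_le (bounded_CkD (IH _ _ fC gC') (IH _ _ fC' gC)).
  by rewrite exprS; lra.
by move=> x Xx /=; rewrite (is_deriv_on_itvE ab Xx (D x Xx)).
Qed.

Lemma is_deriv_on_horner S (p : {poly R}) x :
  is_deriv_on S (fun y => p.[y]) x (p^`()).[x].
Proof.
elim/poly_ind: p => [|p c IH].
  rewrite deriv0 horner0; under eq_fun do rewrite horner0.
  exact: is_deriv_on_cst.
rewrite derivMXaddC hornerD hornerM hornerX.
under eq_fun do rewrite hornerMXaddC.
rewrite -[_ + _]addr0; apply: is_deriv_onD; last exact: is_deriv_on_cst.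
rewrite addrC -[X in _ + X]mulr1; apply: is_deriv_onM => //; exact: is_deriv_on_id.
Qed.

Lemma poly_primitive (q : {poly R}) (x v : R) n : (size q <= n)%N ->
  exists2 p : {poly R}, (size p <= n.+1)%N & p^`() = q /\ p.[x] = v.
Proof.
move=> qn.
(* For [i = 0] the division by zero yields 0; the constant added next fixes the value at [x]. *)
pose p0 := \poly_(i < n.+1) (q`_i.-1 / i%:R).
exists (p0 + (v - p0.[x])%:P).
  rewrite (leq_trans (size_polyD _ _))// geq_max size_poly/=.
  exact: leq_trans (size_polyC_leq1 _) _.
split; last by rewrite hornerD hornerC addrC subrK.
rewrite derivD derivC addr0; apply/polyP => i.
rewrite coef_deriv coef_poly ltnS.
case: leqP => [ni|ni].
  by rewrite mul0rn nth_default// (leq_trans qn).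
by rewrite -[LHS]mulr_natr divfK// pnatr_eq0.
Qed.

(** By induction: [p] is the primitive, equal to [f] at [x0], of the polynomial obtained for the
    derivative. The factorial in the remainder is given up. The bound on the derivative is kept
    because at [y = x0] it forces the derivatives to agree. *)
Lemma taylor_poly n M f x0 : bounded_Ck X n.+1 M f -> X x0 ->
  exists2 p : {poly R}, (size p <= n.+1)%N & forall y, X y ->
    `|f y - p.[y]| <= M * `|y - x0| ^+ n.+1 /\
    `|deriv_on X f y - (p^`()).[y]| <= M * `|y - x0| ^+ n.
Proof.
elim: n f x0 => [|n IH] f x0.
  move=> [fM [fd fC]] Xx0; exists (f x0)%:P; first exact: size_polyC_leq1.
  have D z : X z -> is_deriv_on X f z (deriv_on X f z).
    by move=> Xz; apply: derivable_onP; exact: fd.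
  move=> y Xy; rewrite hornerC derivC horner0 subr0 expr0 mulr1 expr1; split.
    apply: (MVT_abs_le D) => // z _ Xz.
    by case: fC => + _; apply.
  by case: fC => + _; apply.
move=> [fM [fd fC]] Xx0.
have [q qn qE] := IH _ _ fC Xx0.
have [p pn [dp pv]] := poly_primitive x0 (f x0) qn.
exists p => // y Xy; rewrite dp.
split; last by have [] := qE _ Xy.
have D z : X z ->
    is_deriv_on X (fun z => f z - p.[z]) z (deriv_on X f z - q.[z]).
  move=> Xz; apply: is_deriv_onB; first by apply: derivable_onP; exact: fd.
  by rewrite -dp; exact: is_deriv_on_horner.
have := @MVT_abs_le _ _ _ _ _ x0 y (M * `|y - x0| ^+ n.+1) D Xx0 Xy.
rewrite pv subrr subr0 -mulrA -exprSr; apply => z zy Xz.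
have [h _] := qE _ Xz; apply: le_trans h _.
have M0 : 0 <= M by apply: le_trans (fM _ Xx0).
by rewrite ler_wpM2l// lerXn2r// nnegrE.
Qed.

End BoundedDerivatives.

(** * Functions of class C^k on a rectangle *)

Section TwoVariables.
Variable R : realType.
Variables al be ga de : R.
Let X : set R := `[al, be]%classic.
Let I : set R := `[ga, de]%classic.
Implicit Types (u v : R -> R -> R) (x t : R) (n m : nat).

Lemma Ck2_on_cont m u : Ck2_on X I m u ->
  {within X `*` I, continuous (fun z : R * R => u z.1 z.2)}.
Proof. by case: m => [|m] []. Qed.

Lemma Ck2_on_is_deriv m u x t : Ck2_on X I m.+1 u -> X x -> I t ->
  is_deriv_on X (u^~ t) x (ddx X u x t) /\ is_deriv_on I (u x) t (ddt I u x t).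
Proof.
move=> [_ [ud _ _]] Xx It; have [ux ut] := ud _ _ Xx It.
by split; exact: derivable_onP.
Qed.

Lemma Ck2_on_ddx m u : Ck2_on X I m.+1 u -> Ck2_on X I m (ddx X u).
Proof. by case=> _ []. Qed.

Lemma Ck2_on_ddt m u : Ck2_on X I m.+1 u -> Ck2_on X I m (ddt I u).
Proof. by case=> _ []. Qed.

Lemma Ck2_on_leq m n u : (m <= n)%N -> Ck2_on X I n u -> Ck2_on X I m u.
Proof.
elim: n m u => [|n IH] [|m] u // mn; first by move=> /Ck2_on_cont; split.
by move=> [uc [ud ux ut]]; split => //; split => //; exact: IH.
Qed.

Lemma Ck2_on_iter_ddx j m u :
  Ck2_on X I (j + m) u -> Ck2_on X I m (iter j (ddx X) u).
Proof.
elim: j u => [//|j IH] u.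
by rewrite addSn iterSr => /Ck2_on_ddx; exact: IH.
Qed.

Lemma iter_ddxE j u t x :
  iter j (ddx X) u x t = iter j (deriv_on X) (u^~ t) x.
Proof. by elim: j u => [//|j IH] u; rewrite !iterSr IH. Qed.

Lemma compact_rectangle : compact (X `*` I).
Proof. by apply: compact_setX; exact: segment_compact. Qed.

Lemma Ck2_on_bounded m u : Ck2_on X I m u ->
  exists M : R, forall x t, X x -> I t -> `|u x t| <= M.
Proof.
move=> /Ck2_on_cont uc.
have /compact_bounded[M [_ hM]] := continuous_compact uc compact_rectangle.
exists (M + 1) => x t Xx It; apply: (hM (M + 1)); first by rewrite ltrDl.
by exists (x, t).
Qed.

(** Each space derivative is continuous on the compact rectangle, so a single constant serves all
    times. *)
Lemma Ck2_on_bounded_Ck m u : Ck2_on X I m u ->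
  exists M : R, forall t, I t -> bounded_Ck X m M (u^~ t).
Proof.
elim: m u => [|m IH] u uC; have [M hM] := Ck2_on_bounded uC.
  by exists M => t It; split => // x Xx; exact: hM.
have [N hN] := IH _ (Ck2_on_ddx uC).
have NM : N <= Num.max M N by rewrite le_max lexx orbT.
have MN : M <= Num.max M N by rewrite le_max lexx.
exists (Num.max M N) => t It; split.
  by move=> x Xx; apply: le_trans MN; exact: hM.
split; last by apply: bounded_Ck_le NM (hN _ It).
by move=> x Xx; have [/is_deriv_on_derivable] := Ck2_on_is_deriv uC Xx It.
Qed.

Lemma Ck_on_bounded_Ck m (f : R -> R) : Ck_on X m f ->
  exists M : R, bounded_Ck X m M f.
Proof.
have bd (g : R -> R) : {within X, continuous g} ->
    exists M : R, forall x, X x -> `|g x| <= M.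
  move=> gc.
  have /compact_bounded[M [_ hM]] := continuous_compact gc (@segment_compact _ al be).
  exists (M + 1) => x Xx; apply: (hM (M + 1)); first by rewrite ltrDl.
  by exists x.
elim: m f => [|m IH] f /= [fc]; have [M hM] := bd _ fc; first by exists M.
move=> [fd fC]; have [N hN] := IH _ fC.
have NM : N <= Num.max M N by rewrite le_max lexx orbT.
have MN : M <= Num.max M N by rewrite le_max lexx.
exists (Num.max M N); split.
  by move=> x Xx; apply: le_trans MN; exact: hM.
by split => //; apply: bounded_Ck_le NM hN.
Qed.

Lemma within_cont_eps u x t e :
  {within X `*` I, continuous (fun z : R * R => u z.1 z.2)} ->
  X x -> I t -> 0 < e ->
  exists2 d : R, 0 < d & forall y s, X y -> I s -> `|y - x| < d -> `|s - t| < d ->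
    `|u y s - u x t| < e.
Proof.
move=> /subspace_continuousP uc Xx It e0.
have /cvgrPdist_lt /(_ e e0) := uc (x, t) (conj Xx It).
rewrite near_withinE => -[[A B] /= [[d1 /= d10 hA] [d2 /= d20 hB]] AB].
exists (Num.min d1 d2); first by rewrite lt_min d10.
move=> y s Xy Is; rewrite !lt_min => /andP[y1 _] /andP[_ s2].
rewrite distrC; apply: (AB (y, s)) => //; split => /=.
  by apply: hA; rewrite /= distrC.
by apply: hB; rewrite /= distrC.
Qed.

End TwoVariables.

(** The point may be an end point of the interval, so the subinterval is laid on a side where there
    is room and need not surround it. *)
Lemma subitv_near (R : realType) (al be x d : R) :
  al < be -> `[al, be]%classic x -> 0 < d ->
  exists x1 x2 : R, [/\ x1 < x2, al <= x1, x2 <= be &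
    forall y, x1 <= y <= x2 -> `|y - x| < d].
Proof.
move=> ab /=; rewrite in_itv /= => /andP[ax xb] d0.
have [xb'|xb'] := ltP x be.
  have m0 : 0 < Num.min (d / 2) (be - x) by rewrite lt_min; apply/andP; split; lra.
  have m1 : Num.min (d / 2) (be - x) <= d / 2 by rewrite ge_min lexx.
  have m2 : Num.min (d / 2) (be - x) <= be - x by rewrite ge_min lexx orbT.
  exists x, (x + Num.min (d / 2) (be - x)); split; [lra..|].
  by move=> y /andP[? ?]; rewrite ger0_norm; lra.
have m0 : 0 < Num.min (d / 2) (x - al) by rewrite lt_min; apply/andP; split; lra.
have m1 : Num.min (d / 2) (x - al) <= d / 2 by rewrite ge_min lexx.
have m2 : Num.min (d / 2) (x - al) <= x - al by rewrite ge_min lexx orbT.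
exists (x - Num.min (d / 2) (x - al)), x; split; [lra..|].
by move=> y /andP[? ?]; rewrite ler0_norm; lra.
Qed.

(** Schwarz's theorem, including the boundary of the rectangle: the two mixed derivatives take a
    common value at points arbitrarily close to [(x, t)], and both are continuous. *)
Lemma ddt_ddxC (R : realType) (al be ga de : R) (u : R -> R -> R) x t :
  let X := `[al, be]%classic in let I := `[ga, de]%classic in
  al < be -> ga < de -> Ck2_on X I 2 u -> X x -> I t ->
  ddt I (ddx X u) x t = ddx X (ddt I u) x t.
Proof.
move=> X I ab gd uC Xx It.
have uxC := Ck2_on_ddx uC; have utC := Ck2_on_ddt uC.
apply/eqP; rewrite -subr_eq0 -normr_le0; apply/ler_addgt0Pr => e e0; rewrite add0r.
have e2 : 0 < e / 2 by lra.
have [d1 d10 h1] := within_cont_eps (Ck2_on_cont (Ck2_on_ddt uxC)) Xx It e2.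
have [d2 d20 h2] := within_cont_eps (Ck2_on_cont (Ck2_on_ddx utC)) Xx It e2.
have d0 : 0 < Num.min d1 d2 by rewrite lt_min d10.
have [x1 [x2 [x12 ax xb hx]]] := subitv_near ab Xx d0.
have [t1 [t2 [t12 ct td ht]]] := subitv_near gd It d0.
have inX y : x1 <= y <= x2 -> X y.
  by move=> /andP[? ?]; rewrite /X /= in_itv /=; apply/andP; split; lra.
have inI s : t1 <= s <= t2 -> I s.
  by move=> /andP[? ?]; rewrite /I /= in_itv /=; apply/andP; split; lra.
have xx1 : x1 <= x1 <= x2 by rewrite lexx ltW.
have xx2 : x1 <= x2 <= x2 by rewrite lexx ltW.
have tt1 : t1 <= t1 <= t2 by rewrite lexx ltW.
have tt2 : t1 <= t2 <= t2 by rewrite lexx ltW.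
(* The mixed second difference of [u] over a small rectangle is its area times
   either mixed partial derivative at some point of the rectangle. *)
have [y [s [yx st e1]]] : exists y s, [/\ x1 <= y <= x2, t1 <= s <= t2 &
    u x2 t2 - u x2 t1 - (u x1 t2 - u x1 t1)
    = ddt I (ddx X u) y s * (t2 - t1) * (x2 - x1)].
  have D z : X z -> is_deriv_on X (fun z => u z t2 - u z t1) z
      (ddx X u z t2 - ddx X u z t1).
    move=> Xz; apply: is_deriv_onB.
      by have [] := Ck2_on_is_deriv uC Xz (inI _ tt2).
    by have [] := Ck2_on_is_deriv uC Xz (inI _ tt1).
  have [y yx ->] := MVT_on D ax (ltW x12) xb.
  have Dt s : I s -> is_deriv_on I (ddx X u y) s (ddt I (ddx X u) y s).
    by move=> Is; have [] := Ck2_on_is_deriv uxC (inX _ yx) Is.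
  have [s st ->] := MVT_on Dt ct (ltW t12) td.
  by exists y, s.
have [y' [s' [yx' st' e2']]] : exists y s, [/\ x1 <= y <= x2, t1 <= s <= t2 &
    u x2 t2 - u x1 t2 - (u x2 t1 - u x1 t1)
    = ddx X (ddt I u) y s * (x2 - x1) * (t2 - t1)].
  have D z : I z -> is_deriv_on I (fun z => u x2 z - u x1 z) z
      (ddt I u x2 z - ddt I u x1 z).
    move=> Iz; apply: is_deriv_onB.
      by have [] := Ck2_on_is_deriv uC (inX _ xx2) Iz.
    by have [] := Ck2_on_is_deriv uC (inX _ xx1) Iz.
  have [r st' ->] := MVT_on D ct (ltW t12) td.
  have Dt z : X z -> is_deriv_on X ((ddt I u)^~ r) z (ddx X (ddt I u) z r).
    by move=> Xz; have [] := Ck2_on_is_deriv utC Xz (inI _ st').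
  have [z zx ->] := MVT_on Dt ax (ltW x12) xb.
  by exists z, r.
have eq12 : ddt I (ddx X u) y s = ddx X (ddt I u) y' s'.
  have x0 : x2 - x1 != 0 by rewrite subr_eq0 gt_eqF.
  have t0 : t2 - t1 != 0 by rewrite subr_eq0 gt_eqF.
  apply: (mulIf x0); apply: (mulIf t0).
  by rewrite -e2' mulrAC -e1; ring.
have lt1 (z : R) : `|z| < Num.min d1 d2 -> `|z| < d1 /\ `|z| < d2.
  by rewrite lt_min => /andP[].
have [a1 a2] := lt1 _ (hx _ yx); have [b1 b2] := lt1 _ (ht _ st).
have [c1 c2] := lt1 _ (hx _ yx'); have [f1 f2] := lt1 _ (ht _ st').
have := h1 _ _ (inX _ yx) (inI _ st) a1 b1.
have := h2 _ _ (inX _ yx') (inI _ st') c2 f2.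
rewrite eq12 => /ltr_normlP[? ?] /ltr_normlP[? ?].
by rewrite ler_norml; apply/andP; split; lra.
Qed.

(** * Vanishing of the time integral of the Sobolev norm *)

Section ZeroIntegral.
Variable R : realType.
Let mu := @lebesgue_measure R.

Lemma continuous_itv_integrable (al be : R) (f : R -> R) :
  {within `[al, be], continuous f} -> mu.-integrable `[al, be] (EFin \o f).
Proof. by move=> fc; apply: continuous_compact_integrable => //; exact: segment_compact. Qed.

Lemma Rintegral_itv_cst (al be k : R) : al <= be ->
  Rintegral mu `[al, be] (fun=> k) = k * (be - al).
Proof.
move=> ab; rewrite Rintegral_cst//= lebesgue_measure_itv/= lte_fin.
by move: ab; rewrite le_eqVlt => /predU1P[->|->]//; rewrite ltxx subrr.
Qed.

(** If [f x > 0], then [f] exceeds [f x / 2] on a subinterval of positive length, and the integral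
    is positive. *)
Lemma Rintegral_cont_eq0 (al be : R) (f : R -> R) : al < be ->
  {within `[al, be], continuous f} ->
  (forall x, `[al, be]%classic x -> 0 <= f x) ->
  Rintegral mu `[al, be] f <= 0 -> forall x, `[al, be]%classic x -> f x = 0.
Proof.
move=> ab fc f0 If x Xx; apply/eqP/negPn/negP => fx0.
have fx : 0 < f x by rewrite lt_def fx0 f0.
have fx2 : 0 < f x / 2 by lra.
have /subspace_continuousP/(_ x Xx)/cvgrPdist_lt/(_ _ fx2) := fc.
rewrite near_withinE => -[d /= d0 hd].
have [x1 [x2 [x12 ax xb hx]]] := subitv_near ab Xx d0.
have sub : `[x1, x2]%classic `<=` `[al, be]%classic.
  by move=> z /=; rewrite !in_itv /= => /andP[? ?]; apply/andP; split; lra.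
have fi := continuous_itv_integrable fc.
have fi' := continuous_itv_integrable (continuous_subspaceW sub fc).
have h1 : f x / 2 * (x2 - x1) <= Rintegral mu `[x1, x2] f.
  rewrite -(Rintegral_itv_cst _ (ltW x12)); apply: le_Rintegral => //.
    by apply: continuous_itv_integrable; apply: continuous_subspaceT => z; exact: cvg_cst.
  move=> y xy; have yx : `|y - x| < d by apply: hx; move: xy; rewrite /= in_itv.
  have /ltr_normlP[? ?] : `|f x - f y| < f x / 2.
    by apply: hd (sub _ xy); rewrite /= distrC.
  lra.
have h2 : Rintegral mu `[x1, x2] f <= Rintegral mu `[al, be] f.
  rewrite /Rintegral fine_le//; try by apply: integrable_fin_num.
  apply: ge0_subset_integral => //.
  exact: (measurable_int _ fi).
have x0 : 0 < x2 - x1 by rewrite subr_gt0.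
by have := mulr_gt0 fx2 x0; rewrite ltNge (le_trans h1 (le_trans h2 If)).
Qed.

Lemma lipschitz_within_cont (S : set R) (g : R -> R) (L : R) :
  (forall s t, S s -> S t -> `|g s - g t| <= L * `|s - t|) ->
  {within S, continuous g}.
Proof.
move=> gL; apply/subspace_continuousP => t St.
apply/cvgrPdist_lt => e e0.
(* A positive divisor whatever the sign of [L]. *)
have L1 : 0 < `|L| + 1 by rewrite ltr_wpDl.
rewrite near_withinE; exists (e / (`|L| + 1)) => /=; first exact: divr_gt0.
move=> s /= st Ss; apply: le_lt_trans (gL _ _ St Ss) _.
have st' : `|t - s| * (`|L| + 1) < e by rewrite -ltr_pdivlMr.
have := ler_wpM2r (normr_ge0 (t - s)) (ler_norm L).
have := normr_ge0 (t - s); lra.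
Qed.

Variables al be ga de : R.
Hypothesis ab : al < be.
Let X : set R := `[al, be]%classic.
Let I : set R := `[ga, de]%classic.

Lemma Ck2_on_within_cont_x m (v : R -> R -> R) t :
  Ck2_on X I m.+1 v -> I t -> {within X, continuous (v^~ t)}.
Proof.
move=> vC It; apply: (@is_deriv_on_cont _ _ _ (fun x => ddx X v x t)) => x Xx.
by have [] := Ck2_on_is_deriv vC Xx It.
Qed.

Lemma sqr_within_cont (S : set R) (f : R -> R) :
  {within S, continuous f} -> {within S, continuous (fun x => f x ^+ 2)}.
Proof.
by move=> fc x; under eq_fun do rewrite expr2; apply: cvgM; exact: fc.
Qed.

(** The integral is Lipschitz in time: the difference of squares is at most [N * |s - t|] times
    [M + M], with [N] bounding the time derivative and [M] the function. *)
Lemma Ck2_on_sqr_integral_cont (v : R -> R -> R) : Ck2_on X I 1 v ->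
  {within I, continuous (fun t => Rintegral mu X (fun x => v x t ^+ 2))}.
Proof.
move=> vC; have [M hM] := Ck2_on_bounded vC.
have [N hN] := Ck2_on_bounded (Ck2_on_ddt vC).
apply: (@lipschitz_within_cont _ _ (N * (M + M) * (be - al))) => s t Is It.
have vi r : I r -> mu.-integrable X (EFin \o (fun x => v x r ^+ 2)).
  move=> Ir; apply: continuous_itv_integrable; apply: sqr_within_cont.
  exact: Ck2_on_within_cont_x vC Ir.
have mX : measurable (X : set (measurableTypeR R)) by exact: measurable_itv.
rewrite -(RintegralB mX (vi _ Is) (vi _ It)).
apply: le_trans (le_normr_Rintegral _ _) _ => //.
  have := integrableB mX (vi _ Is) (vi _ It).
  by apply: eq_integrable => // x _; rewrite /= EFinB.
rewrite mulrAC -(Rintegral_itv_cst _ (ltW ab)).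
apply: le_Rintegral => //.
- have := integrable_abse (integrableB mX (vi _ Is) (vi _ It)).
  by apply: eq_integrable => // x _; rewrite /= -EFinB.
- by apply: continuous_itv_integrable; apply: continuous_subspaceT => z; exact: cvg_cst.
move=> x Xx; rewrite subr_sqr normrM.
have D z : I z -> is_deriv_on I (v x) z (ddt I v x z).
  by move=> Iz; have [] := Ck2_on_is_deriv vC Xx Iz.
have h1 : `|v x s - v x t| <= N * `|s - t|.
  by apply: (MVT_abs_le D) => // z _ Iz; exact: hN.
have h2 : `|v x s + v x t| <= M + M.
  by rewrite (le_trans (ler_normD _ _))// lerD// hM.
by rewrite mulrAC; apply: ler_pM.
Qed.

(** The order of differentiability exceeds that of the norm by one, so that every term of the norm
    has a bounded time derivative. *)
Lemma sobolev_norm_cont n (u : R -> R -> R) : Ck2_on X I n.+1 u ->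
  {within I, continuous (fun t => sobolev_norm X n (u^~ t))}.
Proof.
move=> uC; apply/subspace_continuousP => t It.
apply: (@continuous_cvg _ _ _ _ _ (fun t => \sum_(j < n.+1)
    Rintegral mu X (fun x => (iter j (deriv_on X) (u^~ t) x) ^+ 2)) Num.sqrt).
  exact: sqrt_continuous.
apply: (cvg_big (op := +%R)); first exact: add_continuous.
move=> j _.
have jC : Ck2_on X I 1 (iter j (ddx X) u).
  apply: Ck2_on_iter_ddx; apply: Ck2_on_leq uC.
  by rewrite addn1 ltnS -ltnS ltn_ord.
have E s : Rintegral mu X (fun x => (iter j (deriv_on X) (u^~ s) x) ^+ 2) =
    Rintegral mu X (fun x => iter j (ddx X) u x s ^+ 2).
  by apply: eq_Rintegral => x _; rewrite iter_ddxE.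
under eq_fun do rewrite E; rewrite E.
have /subspace_continuousP := Ck2_on_sqr_integral_cont jC; exact.
Qed.

Lemma sobolev_norm_eq0 n (u : R -> R -> R) t : Ck2_on X I 1 u -> I t ->
  sobolev_norm X n (u^~ t) = 0 -> forall x, X x -> u x t = 0.
Proof.
move=> uC It /eqP; rewrite sqrtr_eq0 big_ord_recl /= => S0 x Xx.
apply/eqP; rewrite -sqrf_eq0; apply/eqP.
apply: (Rintegral_cont_eq0 ab (f := fun x => u x t ^+ 2)) => //.
- by apply: sqr_within_cont; exact: Ck2_on_within_cont_x uC It.
- by move=> z _; exact: sqr_ge0.
apply: le_trans S0; rewrite lerDl; apply: sumr_ge0 => j _.
by apply: Rintegral_ge0 => z _; exact: sqr_ge0.
Qed.

(** Settles the case where no constant can help because the right-hand side of the error estimate is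
    zero. Continuity in time makes the norm vanish at every instant, and its term of order 0 then
    makes [u] vanish. *)
Lemma sobolev_integral_eq0 n (u : R -> R -> R) t : Ck2_on X I n.+1 u -> ga < t -> t <= de ->
  Rintegral mu `[ga, t] (fun s => sobolev_norm X n (u^~ s)) <= 0 ->
  forall x s, X x -> `[ga, t]%classic s -> u x s = 0.
Proof.
move=> uC gt td I0 x s Xx st.
have sub : `[ga, t]%classic `<=` I.
  by move=> z /=; rewrite /I /= !in_itv /= => /andP[? ?]; apply/andP; split; lra.
apply: (@sobolev_norm_eq0 n) => //; [by apply: Ck2_on_leq uC|exact: sub|].
apply: (Rintegral_cont_eq0 gt (f := fun s => sobolev_norm X n (u^~ s))) => //.
  exact: continuous_subspaceW sub (sobolev_norm_cont uC).
by move=> z _; exact: sqrtr_ge0.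
Qed.

End ZeroIntegral.

(** * The reference element *)

Section ReferenceElement.
Variable R : realType.

Lemma Rintegral_deriv_poly (al be : R) (p : {poly R}) : al < be ->
  Rintegral lebesgue_measure `[al, be] (fun x => (p^`()).[x]) = p.[be] - p.[al].
Proof.
move=> ab; rewrite /Rintegral (@continuous_FTC2 _ _ (fun x => p.[x]))//.
- by apply: continuous_subspaceT; exact: continuous_horner.
- split; first by move=> x _; exact: derivable_horner.
  + by apply: cvg_at_right_filter; exact: continuous_horner.
  + by apply: cvg_at_left_filter; exact: continuous_horner.
- by move=> x _; rewrite derivE.
Qed.

Variables (P : nat) (xi w : 'I_P.+1 -> R).
Hypothesis gll : is_gll xi w.

Lemma gll_inj : injective xi.
Proof.
case: gll => _ xi_lt _ _ _ i j xij.
by apply/val_inj; case: (ltngtP i j) => // /xi_lt; rewrite xij ltxx.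
Qed.

Lemma gll_order_gt0 : (0 < P)%N.
Proof.
case: gll => -[xi0 xi1] _ _ _ _; rewrite lt0n; apply/eqP => P0.
have e : ord0 = ord_max :> 'I_P.+1 by apply/val_inj; rewrite /= P0.
by move: xi0; rewrite e xi1 => ?; lra.
Qed.

Lemma lagrange_polyE i j : (lagrange_poly xi i).[xi j] = (i == j)%:R.
Proof.
rewrite /lagrange_poly horner_prod; have [<-|ij] := eqVneq i j.
  rewrite big1// => k ki; rewrite hornerZ hornerXsubC mulVf//.
  by rewrite subr_eq0 (inj_eq gll_inj) eq_sym.
rewrite (bigD1 j) 1?eq_sym//= hornerZ hornerXsubC subrr mulr0 mul0r//.
Qed.

Lemma size_lagrange_poly i : (size (lagrange_poly xi i) <= P.+1)%N.
Proof.
rewrite /lagrange_poly (leq_trans (size_poly_prod_leq _ _))//.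
have sz j : (size ((xi i - xi j)^-1 *: ('X - (xi j)%:P)) <= 2)%N.
  by rewrite (leq_trans (size_scale_leq _ _))// size_XsubC.
have c : #|[pred j | j != i]| = P.
  by have := cardC1 i; rewrite card_ord.
rewrite c; apply: (@leq_trans ((\sum_(j | j != i) 2).+1 - P)%N).
  by rewrite leq_sub2r// ltnS; apply: leq_sum => j _; exact: sz.
by rewrite sum_nat_const c; lia.
Qed.

(** The difference of the two sides has the [P.+1] nodes as roots and size at most [P.+1]. *)
Lemma lagrange_interpolation (p : {poly R}) : (size p <= P.+1)%N ->
  p = \sum_i p.[xi i] *: lagrange_poly xi i.
Proof.
move=> pP; apply/eqP; rewrite -subr_eq0; apply/negPn/negP => q0.
have := max_poly_roots q0 (rs := [seq xi i | i : 'I_P.+1]).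
rewrite map_inj_uniq ?enum_uniq; last exact: gll_inj.
move=> /(_ _ isT); rewrite size_map size_enum_ord ltnNge => /(_ _)/negP; apply.
  apply/allP => _ /mapP[j _ ->]; rewrite rootE hornerD hornerN horner_sum.
  rewrite (bigD1 j)//= big1 => [|i ij]; rewrite hornerZ lagrange_polyE.
    by rewrite eqxx mulr1 addr0 subrr.
  by rewrite (negbTE ij) mulr0.
rewrite (leq_trans (size_polyD _ _))// geq_max pP size_polyN.
apply: (leq_trans (size_sum _ _ _)); apply/bigmax_leqP => i _.
by rewrite (leq_trans (size_scale_leq _ _))// size_lagrange_poly.
Qed.

(** The quadrature sum collapses to one node, so [D_x] differentiates the interpolating polynomial
    exactly at the nodes. *)
Lemma Qmx_entry i j : Qmx xi w i j = w i * ((lagrange_poly xi j)^`()).[xi i].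
Proof.
rewrite mxE (bigD1 i)//= big1 => [|m mi]; rewrite lagrange_polyE.
  by rewrite eqxx mulr1 addr0.
by rewrite eq_sym (negbTE mi) mulr0 mul0r.
Qed.

Lemma Qmx_sbp i j : Qmx xi w i j + Qmx xi w j i =
  ((i == ord_max) && (j == ord_max))%:R - ((i == ord0) && (j == ord0))%:R.
Proof.
case: (gll) => -[xi0 xiP] _ _ _ quad.
have -> : Qmx xi w i j + Qmx xi w j i =
    \sum_m w m * ((lagrange_poly xi i * lagrange_poly xi j)^`()).[xi m].
  rewrite !mxE -big_split /=; apply: eq_bigr => m _.
  by rewrite derivM hornerD !hornerM; ring.
(* The product of two Lagrange polynomials has size at most [2 * P + 1], its derivative at most
   [2 * P], which is the limit of exactness. The zero product is set apart because the size of its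
   derivative does not drop. *)
rewrite quad; last first.
  have := gll_order_gt0.
  have := lt_size_deriv (p := lagrange_poly xi i * lagrange_poly xi j).
  have := size_polyMleq (lagrange_poly xi i) (lagrange_poly xi j).
  have := size_lagrange_poly i; have := size_lagrange_poly j.
  have [->|_] := eqVneq (lagrange_poly xi i * lagrange_poly xi j) 0.
    by rewrite derivC size_poly0.
  by move=> hi hj hij /(_ isT) h hP; lia.
rewrite Rintegral_deriv_poly; last by lra.
have e1 : (lagrange_poly xi i * lagrange_poly xi j).[1] =
    ((i == ord_max) && (j == ord_max))%:R.
  have := lagrange_polyE i ord_max; have := lagrange_polyE j ord_max.
  by rewrite xiP => ej ei; rewrite hornerM ei ej -natrM mulnb.
have e0 : (lagrange_poly xi i * lagrange_poly xi j).[-1] =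
    ((i == ord0) && (j == ord0))%:R.
  have := lagrange_polyE i ord0; have := lagrange_polyE j ord0.
  by rewrite xi0 => ej ei; rewrite hornerM ei ej -natrM mulnb.
by rewrite e1 e0.
Qed.

Lemma sum_lagrange_deriv (p : {poly R}) x : (size p <= P.+1)%N ->
  \sum_j ((lagrange_poly xi j)^`()).[x] * p.[xi j] = (p^`()).[x].
Proof.
move=> pP; rewrite [in RHS](lagrange_interpolation pP) linear_sum horner_sum.
by apply: eq_bigr => j _; rewrite linearZ /= hornerZ mulrC.
Qed.

End ReferenceElement.

(** * Discrete energy estimates *)

Section WeightedProduct.
Variables (R : realType) (N : nat).
Implicit Types (x y z h : 'cV[R]_N) (k : R).

(** The form [x^T H y] for the diagonal [H] with entries [h], as a sum, so that diagonal matrices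
    move across it termwise. *)
Definition wprod h x y : R := \sum_i h i 0 * (x i 0 * y i 0).

Lemma wprodC h x y : wprod h x y = wprod h y x.
Proof. by apply: eq_bigr => i _; rewrite [x i 0 * _]mulrC. Qed.

Lemma wprodDr h x y z : wprod h x (y + z) = wprod h x y + wprod h x z.
Proof. by rewrite -big_split /=; apply: eq_bigr => i _; rewrite !mxE; ring. Qed.

Lemma wprodNr h x y : wprod h x (- y) = - wprod h x y.
Proof. by rewrite -sumrN; apply: eq_bigr => i _; rewrite !mxE; ring. Qed.

Lemma wprodZr h k x y : wprod h x (k *: y) = k * wprod h x y.
Proof. by rewrite mulr_sumr; apply: eq_bigr => i _; rewrite !mxE; ring. Qed.

Lemma wprodDl h x y z : wprod h (x + y) z = wprod h x z + wprod h y z.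
Proof. by rewrite !(wprodC _ _ z) wprodDr. Qed.

Lemma wprodNl h x y : wprod h (- x) y = - wprod h x y.
Proof. by rewrite !(wprodC _ _ y) wprodNr. Qed.

Lemma wprodZl h k x y : wprod h (k *: x) y = k * wprod h x y.
Proof. by rewrite !(wprodC _ _ y) wprodZr. Qed.

Lemma addv_entry x y i : (x + y) i 0 = x i 0 + y i 0. Proof. exact: mxE. Qed.

Lemma oppv_entry x i : (- x) i 0 = - x i 0. Proof. exact: mxE. Qed.

Lemma scalev_entry k x i : (k *: x) i 0 = k * x i 0. Proof. exact: mxE. Qed.

Definition v_entry := (addv_entry, oppv_entry, scalev_entry).

Lemma diag_entry (d : 'rV[R]_N) x i : (diag_mx d *m x) i 0 = d 0 i * x i 0.
Proof. by rewrite mul_diag_mx mxE. Qed.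

Lemma wprod_diagC h x y (d : 'rV[R]_N) :
  wprod h (diag_mx d *m x) y = wprod h x (diag_mx d *m y).
Proof. by apply: eq_bigr => i _; rewrite !mul_diag_mx !mxE; ring. Qed.

Lemma wprodE h x y : (x^T *m diag_mx h^T *m y) 0 0 = wprod h x y.
Proof.
rewrite -mulmxA mxE; apply: eq_bigr => i _.
by rewrite mul_diag_mx !mxE; ring.
Qed.

Lemma invmx_diag (d : 'rV[R]_N) : (forall i, d 0 i != 0) ->
  invmx (diag_mx d) = diag_mx (map_mx GRing.inv d).
Proof.
move=> d0.
have e : diag_mx d *m diag_mx (map_mx GRing.inv d) = 1%:M.
  rewrite mulmx_diag -diag_const_mx; congr diag_mx.
  by apply/rowP => i; rewrite !mxE mulfV.
have [U _] := mulmx1_unit e.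
by rewrite -[LHS]mulmx1 -e mulKmx.
Qed.

Lemma wprod_inv h x y : (forall i, 0 < h i 0) ->
  wprod h x (invmx (diag_mx h^T) *m y) = \sum_i x i 0 * y i 0.
Proof.
move=> h0; rewrite invmx_diag; last by move=> i; rewrite mxE gt_eqF.
apply: eq_bigr => i _; rewrite mul_diag_mx !mxE.
have : h i 0 != 0 by rewrite gt_eqF.
by move=> ?; field.
Qed.

Lemma dot_trmx (M : 'M[R]_N) x y :
  \sum_i x i 0 * (M^T *m y) i 0 = \sum_i (M *m x) i 0 * y i 0.
Proof.
have e (u v : 'cV[R]_N) : \sum_i u i 0 * v i 0 = (u^T *m v) 0 0.
  by rewrite mxE; apply: eq_bigr => i _; rewrite mxE.
by rewrite !e trmx_mul mulmxA.
Qed.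

(** Entrywise, the difference of the two sides is [h * k^-1 * (k * x - y) ^+ 2]. *)
Lemma wprod_young h x y k : (forall i, 0 <= h i 0) -> 0 < k ->
  2 * wprod h x y <= k * wprod h x x + k^-1 * wprod h y y.
Proof.
move=> h0 k0; rewrite /wprod !mulr_sumr -big_split /=; apply: ler_sum => i _.
have kn : k != 0 by rewrite gt_eqF.
have -> : k * (h i 0 * (x i 0 * x i 0)) + k^-1 * (h i 0 * (y i 0 * y i 0)) =
    2 * (h i 0 * (x i 0 * y i 0)) + h i 0 * (k^-1 * (k * x i 0 - y i 0) ^+ 2).
  by field.
by rewrite lerDl mulr_ge0// mulr_ge0 ?sqr_ge0// invr_ge0 ltW.
Qed.

End WeightedProduct.

(** * Energy estimates for abstract summation-by-parts operators *)

Section DiscreteEnergy.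
Variables (R : realType) (N : nat).
Variables (h : 'cV[R]_N) (D B : 'M[R]_N) (i1 iN : 'I_N).
Hypothesis h_gt0 : forall i, 0 < h i 0.
Let H := diag_mx h^T.
Let Hi : 'M[R]_N := invmx H.
Let Dt : 'M[R]_N := D - 2^-1 *: (Hi *m B).
Let e1 : 'cV[R]_N := delta_mx i1 0.
Let eN : 'cV[R]_N := delta_mx iN 0.
Let Dh : 'M[R]_N := Dt - Hi *m eN *m eN^T.
Hypothesis i1N : i1 != iN.
Hypothesis sbp : forall x y, wprod h x (Dt *m y) + wprod h y (Dt *m x) =
  x iN 0 * y iN 0 - x i1 0 * y i1 0.
Hypothesis B_i1 : forall y, (B *m y : 'cV_N) i1 0 = 0.
Hypothesis B_iN : forall y, (B *m y : 'cV_N) iN 0 = 0.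
Variables (a b : 'rV[R]_N).
Let am := diag_mx a.
Let bm := diag_mx b.
Implicit Types (x y z U V W Wd : 'cV[R]_N).

Lemma inv_diag_entry y i : (Hi *m y) i 0 = y i 0 / h i 0.
Proof.
rewrite /Hi invmx_diag; last by move=> j; rewrite mxE gt_eqF.
by rewrite diag_entry !mxE mulrC.
Qed.

Lemma Dt_entry i y : (forall z, (B *m z : 'cV_N) i 0 = 0) -> (Dt *m y) i 0 = (D *m y) i 0.
Proof.
move=> Bi; rewrite mulmxBl -scalemxAl -mulmxA.
by rewrite !v_entry inv_diag_entry Bi mul0r mulr0 subr0.
Qed.

Lemma delta_outer (i : 'I_N) y : let e : 'cV[R]_N := delta_mx i 0 in
  e *m (e^T *m y) = y i 0 *: e.
Proof.
move=> e; rewrite trmx_delta -rowE.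
by apply/colP => j; rewrite !mxE big_ord1 !mxE; ring.
Qed.

Lemma Dh_entry y i : (Dh *m y) i 0 = (Dt *m y) i 0 - (i == iN)%:R * y iN 0 / h iN 0.
Proof.
rewrite mulmxBl !v_entry; congr (_ - _).
rewrite -!mulmxA delta_outer inv_diag_entry v_entry mxE andbT.
by have [->|_] := eqVneq i iN; rewrite ?mulr1 ?mul1r// mulr0 !mul0r.
Qed.

Lemma wprod_delta x i k : wprod h x (Hi *m (k *: delta_mx i 0)) = k * x i 0.
Proof.
rewrite wprod_inv// (bigD1 i)//= big1 => [|j ji]; rewrite !mxE.
  by rewrite !eqxx mulr1 addr0 mulrC.
by rewrite (negbTE ji) mulr0 mulr0.
Qed.

Let flux W U : 'cV[R]_N := am *m W + bm *m D *m U.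
Let main_part (Wd W U : 'cV[R]_N) : 'cV[R]_N := Wd - D *m flux W U + 2^-1 *: (Hi *m B *m flux W U)
  + Hi *m (- (2^-1 *: (D^T *m bm *m B)) + 4^-1 *: (B^T *m bm *m Hi *m B)) *m U.

(** The flux contains [D U = Dt U + 2^-1 Hi B U]. The two penalty terms together are [- 2^-1] times
    the adjoint of [Dt] applied to [b Hi B U], hence they cancel the surplus and leave a form
    symmetric in [Dt x] and [Dt U]. *)
Lemma wprod_main_part x Wd W U :
  wprod h x (main_part Wd W U) =
  wprod h x Wd - (x iN 0 * flux W U iN 0 - x i1 0 * flux W U i1 0)
  + wprod h (Dt *m x) (am *m W) + wprod h (Dt *m x) (bm *m (Dt *m U)).
Proof.
set F := flux W U; rewrite /main_part -/F.
have DtE (z : 'cV[R]_N) : Dt *m z = D *m z - 2^-1 *: (Hi *m (B *m z)).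
  by rewrite mulmxBl -scalemxAl -mulmxA.
have -> : Wd - D *m F + 2^-1 *: (Hi *m B *m F) = Wd - Dt *m F.
  by rewrite DtE opprB -mulmxA addrA addrAC.
have sbpF := sbp x F.
have wF : wprod h (Dt *m x) F = wprod h F (Dt *m x) by exact: wprodC.
have -> : wprod h x (Wd - Dt *m F + Hi *m (- (2^-1 *: (D^T *m bm *m B)) +
    4^-1 *: (B^T *m bm *m Hi *m B)) *m U) = wprod h x Wd - wprod h x (Dt *m F)
    - 2^-1 * wprod h (Dt *m x) (bm *m (Hi *m (B *m U))).
  rewrite !wprodDr wprodNr; congr (_ + _).
  rewrite -mulmxA wprod_inv// mulmxDl mulNmx -!scalemxAl -!mulmxA.
  set J := Hi *m (B *m U).
  have HJ (z : 'cV[R]_N) : \sum_i z i 0 * (bm *m (B *m U)) i 0 = wprod h z (bm *m J).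
    apply: eq_bigr => i _; rewrite !diag_entry inv_diag_entry.
    have : h i 0 != 0 by rewrite gt_eqF.
    by move=> ?; field.
  have HJ' (z : 'cV[R]_N) : \sum_i (B *m z) i 0 * (bm *m J) i 0 =
      wprod h (Hi *m (B *m z)) (bm *m J).
    apply: eq_bigr => i _; rewrite [in RHS]inv_diag_entry.
    have : h i 0 != 0 by rewrite gt_eqF.
    by move=> ?; field.
  transitivity (- (2^-1 * \sum_i x i 0 * (D^T *m (bm *m (B *m U))) i 0)
    + 4^-1 * \sum_i x i 0 * (B^T *m (bm *m J)) i 0).
    rewrite !mulr_sumr -sumrN -big_split /=; apply: eq_bigr => i _.
    by rewrite !v_entry; ring.
  rewrite !dot_trmx HJ HJ' DtE wprodDl wprodNl wprodZl.
  by field.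
have -> : wprod h (Dt *m x) (bm *m (Dt *m U)) = wprod h (Dt *m x) F -
    wprod h (Dt *m x) (am *m W) - 2^-1 * wprod h (Dt *m x) (bm *m (Hi *m (B *m U))).
  rewrite (DtE U) mulmxBr -scalemxAr /F /flux -mulmxA !wprodDr wprodNr wprodZr.
  by ring.
by rewrite wF; lra.
Qed.

(** The vector [Wd + am Dt V] is the acceleration [dV/dt], since [W = V - am Dt U]. In the volume,
    [b] and [- a ^ 2] merge into [c]. At each end [l1 * l2 = a ^ 2 - b] removes [D U] from the
    boundary terms, leaving [V ^ 2] with the weight [k1] or [kN], the square root of [b]. *)
Lemma energy_identity_pos U V Wd (l1 l2 : 'rV[R]_N) (k1 kN : R) :
  let W := V - am *m Dt *m U in
  let Rb := l2 0 i1 *: (Hi *m e1 *m e1^T *m (V - diag_mx l1 *m D *m U))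
    - l1 0 iN *: (Hi *m eN *m eN^T *m (V - diag_mx l2 *m D *m U)) in
  b 0 i1 = k1 ^+ 2 -> b 0 iN = kN ^+ 2 ->
  l1 0 i1 = a 0 i1 + k1 -> l1 0 iN = a 0 iN + kN ->
  l2 0 i1 = a 0 i1 - k1 -> l2 0 iN = a 0 iN - kN ->
  wprod h V (main_part Wd W U - Rb) =
  wprod h V (Wd + am *m Dt *m V)
  + wprod h (Dt *m U) (diag_mx (\row_i (b 0 i - a 0 i ^+ 2)) *m (Dt *m V))
  + k1 * V i1 0 ^+ 2 + kN * V iN 0 ^+ 2.
Proof.
move=> W Rb b1 bN l11 l1N l21 l2N.
have fluxE i : (forall z, (B *m z : 'cV_N) i 0 = 0) -> flux W U i 0 =
    a 0 i * V i 0 + (b 0 i - a 0 i ^+ 2) * (D *m U) i 0.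
  move=> Bi; rewrite /flux /W -!mulmxA !(v_entry, diag_entry).
  by rewrite (Dt_entry _ Bi); ring.
have RbE : wprod h V Rb =
    l2 0 i1 * ((V i1 0 - l1 0 i1 * (D *m U) i1 0) * V i1 0)
    - l1 0 iN * ((V iN 0 - l2 0 iN * (D *m U) iN 0) * V iN 0).
  rewrite /Rb wprodDr wprodNr !wprodZr -!(mulmxA Hi) -!(mulmxA e1) -!(mulmxA eN).
  rewrite !delta_outer !wprod_delta.
  have dE (l : 'rV[R]_N) i : (V - diag_mx l *m D *m U) i 0 = V i 0 - l 0 i * (D *m U) i 0.
    by rewrite -mulmxA !(v_entry, diag_entry).
  by rewrite !dE.
rewrite wprodDr wprodNr wprod_main_part RbE !fluxE// wprodDr.
have -> : wprod h (Dt *m V) (am *m W) = wprod h V (am *m Dt *m V) -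
    wprod h (Dt *m U) (am *m (am *m (Dt *m V))).
  rewrite /W -wprod_diagC wprodDr wprodNr; congr (_ - _).
    by rewrite -mulmxA wprodC.
  by rewrite -mulmxA -[in RHS]wprod_diagC wprod_diagC -wprod_diagC wprodC.
have -> : diag_mx (\row_i (b 0 i - a 0 i ^+ 2)) *m (Dt *m V) =
    bm *m (Dt *m V) - am *m (am *m (Dt *m V)).
  by apply/colP => i; rewrite !(v_entry, diag_entry) mxE; ring.
rewrite [in RHS]wprodDr wprodNr -[in RHS]wprod_diagC.
rewrite [wprod h (bm *m _) _]wprodC.
by rewrite l11 l1N l21 l2N b1 bN; ring.
Qed.

(** With [Y = Dh U], the relation [V = W + a0 Y] turns the potential term into
    [b0 <Y, Dh W> + a0 b0 <Y, Dh Y>]. The boundary penalties in [Rb] are those that complete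
    [<Dt W, Dt U>] to [<Y, Dh W>]. What remains is a sum of boundary squares at the right end and a
    quadratic form in [W] and [Y] at the left end. *)
Lemma energy_inequality_neg U V Wd (a0 b0 : R) :
  (forall i, a 0 i = a0) -> (forall i, b 0 i = b0) ->
  0 < a0 -> 0 < b0 -> b0 - a0 ^+ 2 < 0 ->
  forall W, W = V - am *m Dh *m U ->
  wprod h W Wd + wprod h (Dh *m U) (bm *m (Dh *m V)) <=
  wprod h W (main_part Wd W U - (- (Hi *m eN *m eN^T *m am *m W)
    - Hi *m (- (D^T *m bm *m eN *m eN^T)
             + eN *m eN^T *m bm *m Hi *m eN *m eN^T) *m U)).
Proof.
move=> aE bE a_gt0 b_gt0 c_lt0 W WE; set Rb := (X in main_part Wd W U - X).
have amE (z : 'cV[R]_N) : am *m z = a0 *: z by apply/colP => i; rewrite diag_entry v_entry aE.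
have bmE (z : 'cV[R]_N) : bm *m z = b0 *: z by apply/colP => i; rewrite diag_entry v_entry bE.
pose Y := Dh *m U.
have VE : V = W + a0 *: Y by rewrite WE -mulmxA amE subrK.
have DhE (z : 'cV[R]_N) : Dh *m z = Dt *m z - Hi *m (z iN 0 *: eN).
  by rewrite mulmxBl -!mulmxA delta_outer.
have Y1 : (D *m U) i1 0 = Y i1 0.
  by rewrite /Y Dh_entry (negbTE i1N) !mul0r subr0 (Dt_entry _ B_i1).
have hN : h iN 0 != 0 by rewrite gt_eqF.
have RbE : wprod h W Rb = - (a0 * W iN 0 ^+ 2) + b0 * (D *m W) iN 0 * U iN 0
    - b0 * W iN 0 * U iN 0 / h iN 0.
  rewrite /Rb wprodDr !wprodNr.
  have -> : Hi *m eN *m eN^T *m am *m W = Hi *m ((a0 * W iN 0) *: eN).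
    by rewrite -!mulmxA delta_outer amE v_entry.
  rewrite wprod_delta -mulmxA mulmxDl mulNmx -!mulmxA.
  have -> : eN *m (eN^T *m (bm *m (Hi *m (eN *m (eN^T *m U))))) =
      (b0 * (U iN 0 / h iN 0)) *: eN.
    rewrite !delta_outer.
    by rewrite bmE !v_entry inv_diag_entry v_entry mxE !eqxx mulr1.
  have -> : bm *m (eN *m (eN^T *m U)) = (b0 * U iN 0) *: eN.
    by rewrite delta_outer bmE scalerA.
  rewrite mulmxDr wprodDr wprod_delta mulmxN wprodNr wprod_inv// dot_trmx.
  rewrite (bigD1 iN)//= big1 => [|j ji]; rewrite v_entry [eN _ _]mxE.
    by rewrite !eqxx /= mulr1 addr0; field.
  by rewrite (negbTE ji) /= !mulr0.
have sbpW := sbp W W; have sbpY := sbp Y Y.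
have wprod_eN z k : wprod h (Hi *m (k *: eN)) z = k * z iN 0.
  by rewrite wprodC wprod_delta.
(* The three corrections, multiplied by [b0], are the right-end part of the flux and the two terms
   of [RbE] in [U]. *)
have YW : wprod h Y (Dh *m W) = wprod h (Dt *m W) (Dt *m U)
    - W iN 0 * (D *m U) iN 0 - U iN 0 * (D *m W) iN 0 + U iN 0 * W iN 0 / h iN 0.
  rewrite /Y !DhE wprodDr !wprodDl !wprodNr !wprodNl wprod_delta wprod_eN.
  rewrite wprod_eN inv_diag_entry v_entry [eN _ _]mxE !eqxx /= mulr1.
  rewrite !(Dt_entry _ B_iN) (wprodC h (Dt *m U)).
  by ring.
have YY : wprod h Y (Dh *m Y) = wprod h Y (Dt *m Y) - Y iN 0 ^+ 2.
  by rewrite DhE wprodDr wprodNr wprod_delta expr2.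
have -> : wprod h (Dh *m U) (bm *m (Dh *m V)) =
    b0 * (wprod h Y (Dh *m W) + a0 * wprod h Y (Dh *m Y)).
  by rewrite bmE wprodZr {1}VE mulmxDr -scalemxAr wprodDr wprodZr.
have fluxE i : flux W U i 0 = a0 * W i 0 + b0 * (D *m U) i 0.
  by rewrite /flux -mulmxA amE bmE !v_entry.
rewrite YW YY wprodDr wprodNr wprod_main_part RbE !fluxE amE bmE !wprodZr Y1.
rewrite (wprodC _ (Dt *m W) W).
(* The boundary form at the left end is positive definite because [c < 0]. *)
have q : 0 <= a0 / 2 * W i1 0 ^+ 2 + b0 * (W i1 0 * Y i1 0) + a0 * b0 / 2 * Y i1 0 ^+ 2.
  have -> : a0 / 2 * W i1 0 ^+ 2 + b0 * (W i1 0 * Y i1 0) + a0 * b0 / 2 * Y i1 0 ^+ 2 =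
     (2 * a0)^-1 * ((a0 * W i1 0 + b0 * Y i1 0) ^+ 2 + b0 * (a0 ^+ 2 - b0) * Y i1 0 ^+ 2).
    by field; rewrite gt_eqF.
  apply: mulr_ge0; first by rewrite invr_ge0; lra.
  apply: addr_ge0; first exact: sqr_ge0.
  apply: mulr_ge0; last exact: sqr_ge0.
  by apply: mulr_ge0; [exact: ltW|rewrite subr_ge0 ltW// -subr_lt0].
have qN : 0 <= a0 / 2 * W iN 0 ^+ 2 by apply: mulr_ge0 (sqr_ge0 _); lra.
have qY : 0 <= a0 * b0 / 2 * Y iN 0 ^+ 2.
  by rewrite mulr_ge0 ?sqr_ge0// divr_ge0// mulr_ge0// ltW.
have -> : wprod h W (Dt *m W) = (W iN 0 ^+ 2 - W i1 0 ^+ 2) / 2.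
  by rewrite !expr2; lra.
have -> : wprod h Y (Dt *m Y) = (Y iN 0 ^+ 2 - Y i1 0 ^+ 2) / 2.
  by rewrite !expr2; lra.
rewrite -subr_ge0; apply: le_trans (addr_ge0 (addr_ge0 q qN) qY) _.
by rewrite le_eqVlt; apply/orP; left; apply/eqP; field.
Qed.

End DiscreteEnergy.

(** * Grid operators *)

Section Grid.
Variables (R : realType) (P : nat) (xi w : 'I_P.+1 -> R) (Bm Bp : R) (n : nat).
Hypothesis gll : is_gll xi w.
Hypothesis BmBp : Bm < Bp.
Let K := n.+1.
Let N := gsize K P.
Let dx := mesh_size Bm Bp K.
Implicit Types (x y v : 'cV[R]_N) (k l : 'I_K) (i j : 'I_P.+1).

Definition gidx k j : 'I_N := @tagnat.Rank K (fun=> P.+1) k j.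
Let d i j := ((lagrange_poly xi j)^`()).[xi i].
Definition hvec : 'cV[R]_N := \mxcol_(k < K) \col_(j < P.+1) (dx / 2 * w j).

Lemma gidxP (I : 'I_N) : exists k j, I = gidx k j.
Proof. by exists (tagnat.sig1 I), (tagnat.sig2 I); rewrite /gidx tagnat.sig2K. Qed.

Lemma gidx_eq k l i j : (gidx k i == gidx l j) = (k == l) && (i == j).
Proof. by rewrite -val_eqE /= tagnat.eq_Rank. Qed.

Lemma sum_gidx (F : 'I_N -> R) : \sum_I F I = \sum_k \sum_j F (gidx k j).
Proof.
rewrite pair_big /=.
rewrite (reindex (fun p : 'I_K * 'I_P.+1 => gidx p.1 p.2))//=.
exists (fun I : 'I_N => (tagnat.sig1 I, tagnat.sig2 I : 'I_P.+1)).
  move=> [k j] _ /=; apply/eqP; rewrite xpair_eqE -gidx_eq.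
  by rewrite /gidx tagnat.sig2K.
by move=> I _ /=; rewrite /gidx tagnat.sig2K.
Qed.

Lemma mesh_gt0 : 0 < dx.
Proof. by rewrite /dx /mesh_size divr_gt0 ?ltr0n// subr_gt0. Qed.

Lemma mesh_le : dx <= Bp - Bm.
Proof. by rewrite /dx /mesh_size ler_pdivrMr ?ltr0n// ler_peMr ?subr_ge0 ?(ltW BmBp) ?ler1n. Qed.

Lemma mxcol_entry (F : 'I_K -> 'cV[R]_P.+1) k j :
  (\mxcol_(k < K) F k : 'cV_N) (gidx k j) 0 = F k j 0.
Proof. by have /matrixP/(_ j 0) := mxcolK F k; rewrite !mxE. Qed.

Lemma nodal_entry (f : R -> R) k j :
  nodal xi Bm Bp K f (gidx k j) 0 = f (node xi Bm Bp k j).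
Proof. by rewrite /nodal mxcol_entry mxE. Qed.

Lemma hvec_entry k j : hvec (gidx k j) 0 = dx / 2 * w j.
Proof. by rewrite /hvec mxcol_entry mxE. Qed.

Lemma w_gt0 j : 0 < w j. Proof. by case: gll. Qed.

Lemma hvec_gt0 I : 0 < hvec I 0.
Proof.
by have [k [j ->]] := gidxP I; rewrite hvec_entry mulr_gt0 ?w_gt0// divr_gt0 ?mesh_gt0.
Qed.

Lemma mxdiag_entry (A : 'I_K -> 'M[R]_P.+1) k l i j :
  (\mxdiag_(k < K) A k : 'M[R]_N) (gidx k i) (gidx l j) = if k == l then A k i j else 0.
Proof.
rewrite /mxdiag.
have /matrixP/(_ i j) := mxblockK (fun k l : 'I_K =>
  (if k == l then conform_mx 0 (A k) else 0) : 'M[R]_(P.+1, P.+1)) k l.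
by rewrite /submxblock mxE => ->; case: eqP => _; rewrite ?conform_mx_id ?mxE.
Qed.

Lemma HgE : Hg w Bm Bp K = diag_mx hvec^T.
Proof.
apply/matrixP => I J; have [k [i ->]] := gidxP I; have [l [j ->]] := gidxP J.
rewrite mxdiag_entry [RHS]mxE [hvec^T _ _]mxE gidx_eq hvec_entry /Hx.
by case: (k =P l) => _ //=; rewrite !mxE; case: (i =P j) => _; rewrite ?mulr1n ?mulr0n ?mulr0.
Qed.

Lemma Dx_entry i j : Dx xi w dx i j = 2 / dx * d i j.
Proof.
have dx0 : dx != 0 by rewrite gt_eqF ?mesh_gt0.
have w0 m : w m != 0 by rewrite gt_eqF ?w_gt0.
have HxE : Hx w dx = diag_mx (\row_j (dx / 2 * w j)).
  apply/matrixP => p q; rewrite !mxE; case: eqP => _; by rewrite ?mulr1n ?mulr0n ?mulr0.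
rewrite /Dx HxE invmx_diag; last first.
  by move=> m; rewrite mxE mulf_neq0// mulf_neq0// invr_neq0// pnatr_eq0.
rewrite mul_diag_mx mxE Qmx_entry// !mxE /d.
by field; rewrite dx0 w0.
Qed.

Lemma Dg_entry v k i :
  (Dg xi w Bm Bp K *m v) (gidx k i) 0 = 2 / dx * \sum_j d i j * v (gidx k j) 0.
Proof.
rewrite mxE sum_gidx (bigD1 k)//= [X in _ + X]big1 ?addr0; last first.
  move=> l lk; apply: big1 => j _.
  by rewrite mxdiag_entry eq_sym (negbTE lk) mul0r.
rewrite mulr_sumr; apply: eq_bigr => j _.
by rewrite mxdiag_entry eqxx -/dx Dx_entry mulrA.
Qed.

Lemma Bhat_mul v : Bhat R K P *m v =
  \sum_(k < K) \sum_(l < K | l == k.+1 :> nat)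
     (v (gidx k ord_max) 0 - v (gidx l ord0) 0) *:
     (@delta_grid R K P k ord_max + @delta_grid R K P l ord0).
Proof.
rewrite /Bhat mulmx_suml; apply: eq_bigr => k _.
rewrite mulmx_suml; apply: eq_bigr => l _.
rewrite -mulmxA linearB /= mulmxBl /delta_grid !trmx_delta -!rowE -/(gidx _ _).
apply/colP => I; rewrite !mxE big_ord1 !mxE [(0 : 'I_1) == 0]eqxx.
by rewrite mulrC.
Qed.

Lemma delta_grid_entry k l i j :
  delta_grid R k i (gidx l j) 0 = ((l == k) && (j == i))%:R.
Proof. by rewrite mxE -/(gidx _ _) gidx_eq andbT. Qed.

Lemma Bhat_entry v m j : (Bhat R K P *m v) (gidx m j) 0 =
  \sum_(k < K) \sum_(l < K | l == k.+1 :> nat)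
     (v (gidx k ord_max) 0 - v (gidx l ord0) 0) *
     (((m == k) && (j == ord_max))%:R + ((m == l) && (j == ord0))%:R).
Proof.
rewrite Bhat_mul summxE; apply: eq_bigr => k _.
rewrite summxE; apply: eq_bigr => l _.
by rewrite !v_entry !delta_grid_entry.
Qed.

Lemma ord0_neq_max : (@ord0 P == ord_max) = false.
Proof. by have := gll_order_gt0 gll; rewrite -val_eqE /= => /gtn_eqF; rewrite eq_sym. Qed.

Let i1 := gidx ord0 ord0.
Let iN := gidx ord_max ord_max.

Lemma Bhat_first v : (Bhat R K P *m v) i1 0 = 0.
Proof.
rewrite Bhat_entry; apply: big1 => k _; apply: big1 => l /eqP lk.
rewrite ord0_neq_max andbF eqxx andbT.
have -> : (ord0 == l) = false by rewrite -val_eqE /= lk.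
by rewrite addr0 mulr0.
Qed.

Lemma Bhat_last v : (Bhat R K P *m v) iN 0 = 0.
Proof.
rewrite Bhat_entry; apply: big1 => k _; apply: big1 => l /eqP lk.
rewrite eqxx andbT [ord_max == ord0]eq_sym ord0_neq_max andbF addr0.
have -> : (ord_max == k) = false.
  by rewrite -val_eqE /= gtn_eqF//; have := ltn_ord l; rewrite lk ltnS.
by rewrite mulr0.
Qed.

Lemma first_neq_last : i1 != iN.
Proof. by rewrite gidx_eq ord0_neq_max andbF. Qed.

Lemma sum_succ (F : 'I_K -> R) k :
  \sum_(l < K | l == k.+1 :> nat) F k = if k == ord_max then 0 else F k.
Proof.
have [->|kn] := eqVneq k ord_max.
  by apply: big1 => l /eqP ln; have := ltn_ord l; rewrite ln /= ltnn.
have kn' : (k.+1 < K)%N.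
  have := ltn_ord k; rewrite /K !ltnS leq_eqVlt => /predU1P[kE|//].
  by move: kn; rewrite -val_eqE /= kE eqxx.
by rewrite (big_pred1 (Ordinal kn')).
Qed.

Lemma sum_pred (F : 'I_K -> R) l :
  \sum_(k < K | l == k.+1 :> nat) F l = if l == ord0 then 0 else F l.
Proof.
have [->|l0] := eqVneq l ord0; first by apply: big1 => k /eqP.
have l0' : (0 < l)%N by move: l0; rewrite -val_eqE /= lt0n.
have ln : (l.-1 < K)%N by rewrite (leq_ltn_trans (leq_pred _) (ltn_ord l)).
rewrite (big_pred1 (Ordinal ln))// => k /=.
by rewrite -[RHS]val_eqE /= -(prednK l0') eqSS eq_sym.
Qed.

(** Each interface owns the right end of one element and the left end of the next; only the two ends
    of the domain are left over. *)
Lemma sum_interface (F G : 'I_K -> R) :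
  \sum_(k < K) \sum_(l < K | l == k.+1 :> nat) (F k - G l) =
  \sum_k (F k - G k) - (F ord_max - G ord0).
Proof.
have -> : \sum_(k < K) \sum_(l < K | l == k.+1 :> nat) (F k - G l) =
   \sum_(k < K) \sum_(l < K | l == k.+1 :> nat) F k -
   \sum_(l < K) \sum_(k < K | l == k.+1 :> nat) G l.
  rewrite [X in _ - X](exchange_big_dep xpredT)//= -sumrB.
  by apply: eq_bigr => k _; rewrite sumrB.
under eq_bigr do rewrite sum_succ.
under [X in _ - X]eq_bigr do rewrite sum_pred.
have skip (E : 'I_K -> R) m : \sum_k (if k == m then 0 else E k) = \sum_k E k - E m.
  rewrite [in RHS](bigD1 m)//= (bigD1 m)//= eqxx add0r [E m + _]addrC addrK.
  by apply: eq_bigr => k /negbTE ->.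
by rewrite !skip sumrB; ring.
Qed.

Lemma Dtilde_mul v : Dtilde xi w Bm Bp K *m v = Dg xi w Bm Bp K *m v
   - 2^-1 *: (invmx (Hg w Bm Bp K) *m (Bhat R K P *m v)).
Proof. by rewrite mulmxBl -scalemxAl -mulmxA. Qed.

(** Elementwise summation by parts leaves the products at both ends of every element. At an
    interface, [(y^- - y^+) (x^- + x^+)] plus its mirror image is [2 (x^- y^- - x^+ y^+)], so half
    of it removes exactly the interior contributions. *)
Lemma Dtilde_sbp x y :
  wprod hvec x (Dtilde xi w Bm Bp K *m y) + wprod hvec y (Dtilde xi w Bm Bp K *m x) =
  x iN 0 * y iN 0 - x i1 0 * y i1 0.
Proof.
have D1 u v : wprod hvec u (Dg xi w Bm Bp K *m v) =
    \sum_k \sum_i \sum_j (Qmx xi w i j * (u (gidx k i) 0 * v (gidx k j) 0)).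
  rewrite /wprod sum_gidx; apply: eq_bigr => k _; apply: eq_bigr => i _.
  rewrite Dg_entry hvec_entry !mulr_sumr; apply: eq_bigr => j _.
  have dx0 : dx != 0 by rewrite gt_eqF ?mesh_gt0.
  by rewrite Qmx_entry// /d; field.
have DD : wprod hvec x (Dg xi w Bm Bp K *m y) + wprod hvec y (Dg xi w Bm Bp K *m x) =
    \sum_k (x (gidx k ord_max) 0 * y (gidx k ord_max) 0 -
            x (gidx k ord0) 0 * y (gidx k ord0) 0).
  rewrite !D1 -big_split /=; apply: eq_bigr => k _.
  rewrite [X in _ + X]exchange_big /= -big_split /=.
  transitivity (\sum_i \sum_j (((i == ord_max) && (j == ord_max))%:R -
      ((i == ord0) && (j == ord0))%:R) * (x (gidx k i) 0 * y (gidx k j) 0)).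
    apply: eq_bigr => i _; rewrite -big_split /=; apply: eq_bigr => j _.
    by rewrite -(Qmx_sbp gll); ring.
  have one (p : 'I_P.+1) : \sum_i \sum_j ((i == p) && (j == p))%:R *
      (x (gidx k i) 0 * y (gidx k j) 0) = x (gidx k p) 0 * y (gidx k p) 0.
    rewrite (bigD1 p)//= [X in _ + X]big1 ?addr0; last first.
      by move=> i ip; apply: big1 => j _; rewrite (negbTE ip) mul0r.
    rewrite (bigD1 p)//= [X in _ + X]big1 ?addr0; last first.
      by move=> j jp; rewrite (negbTE jp) andbF mul0r.
    by rewrite !eqxx mul1r.
  rewrite -!one -sumrB; apply: eq_bigr => i _.
  by rewrite -sumrB; apply: eq_bigr => j _; rewrite mulrBl.
have B1 u v : wprod hvec u (invmx (Hg w Bm Bp K) *m (Bhat R K P *m v)) =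
    \sum_(k < K) \sum_(l < K | l == k.+1 :> nat)
      (v (gidx k ord_max) 0 - v (gidx l ord0) 0) *
      (u (gidx k ord_max) 0 + u (gidx l ord0) 0).
  rewrite HgE wprod_inv; last exact: hvec_gt0.
  rewrite Bhat_mul; under eq_bigr do rewrite summxE mulr_sumr.
  rewrite exchange_big /=; apply: eq_bigr => k _.
  under eq_bigr do rewrite summxE mulr_sumr.
  rewrite exchange_big /=; apply: eq_bigr => l _.
  have one (J : 'I_N) : \sum_I u I 0 * (I == J)%:R = u J 0.
    rewrite (bigD1 J)//= eqxx mulr1 big1 ?addr0// => I IJ.
    by rewrite (negbTE IJ) mulr0.
  rewrite -[u (gidx k _) 0]one -[u (gidx l _) 0]one -big_split mulr_sumr /=.
  by apply: eq_bigr => I _; rewrite !v_entry !mxE !andbT; ring.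
have BB : wprod hvec x (invmx (Hg w Bm Bp K) *m (Bhat R K P *m y)) +
    wprod hvec y (invmx (Hg w Bm Bp K) *m (Bhat R K P *m x)) =
    2 * \sum_(k < K) \sum_(l < K | l == k.+1 :> nat)
      (x (gidx k ord_max) 0 * y (gidx k ord_max) 0 -
       x (gidx l ord0) 0 * y (gidx l ord0) 0).
  rewrite !B1 -big_split mulr_sumr /=; apply: eq_bigr => k _.
  by rewrite -big_split mulr_sumr /=; apply: eq_bigr => l _; ring.
rewrite !Dtilde_mul !wprodDr !wprodNr !wprodZr.
have := DD; have := BB.
rewrite (sum_interface (fun k => x (gidx k ord_max) 0 * y (gidx k ord_max) 0)
  (fun k => x (gidx k ord0) 0 * y (gidx k ord0) 0)).
by rewrite -/i1 -/iN; lra.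
Qed.

Lemma e_firstE : e_first R N = delta_mx i1 0.
Proof.
apply/colP => I; rewrite !mxE andbT; congr (_%:R); congr nat_of_bool.
suff -> : (0 = i1 :> nat)%N by [].
by rewrite /i1 /gidx tagnat.RankEsum big_pred0.
Qed.

Lemma e_lastE : e_last R N = delta_mx iN 0.
Proof.
clear gll BmBp.
apply/colP => I; rewrite !mxE andbT; congr (_%:R); congr nat_of_bool.
have e : (iN.+1 = N)%N.
  rewrite /iN /gidx tagnat.RankEsum big_mkcond big_ord_recr /= ltnn addn0.
  under eq_bigr do rewrite ltn_ord.
  by rewrite /N /K !sum_nat_const !card_ord; lia.
by rewrite -[X in _ == X]e eqSS.
Qed.

Lemma node_first : node xi Bm Bp (ord0 : 'I_K) ord0 = Bm.
Proof. by case: gll => -[xi0 _] _ _ _ _; rewrite /node xi0 addNr mul0r addr0 mulr0 addr0. Qed.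

Lemma node_last : node xi Bm Bp (ord_max : 'I_K) ord_max = Bp.
Proof.
case: gll => -[_ xi1] _ _ _ _; rewrite /node xi1 /mesh_size /=.
have K0 : K%:R != 0 :> R by rewrite pnatr_eq0.
by move: K0; rewrite /K -[n.+1%:R]natr1 => K0; field.
Qed.

Lemma xi_itv j : -1 <= xi j <= 1.
Proof.
case: gll => -[xi0 xi1] lt _ _ _; apply/andP; split.
  have [->|j0] := eqVneq j ord0; first by rewrite xi0.
  by rewrite -xi0 ltW// lt// lt0n.
have [->|j1] := eqVneq j ord_max; first by rewrite xi1.
rewrite -xi1 ltW// lt//; have := ltn_ord j; rewrite ltnS leq_eqVlt => /predU1P[e|//].
by move: j1; rewrite -val_eqE /= e eqxx.
Qed.

Lemma node_itv k j : `[Bm, Bp]%classic (node xi Bm Bp k j).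
Proof.
have /andP[x0 x1] := xi_itv j.
have dx0 := mesh_gt0; have k0 : 0 <= k%:R :> R by [].
have kn : k%:R <= n%:R :> R by rewrite ler_nat -ltnS ltn_ord.
have dxE : dx * n.+1%:R = Bp - Bm by rewrite /dx /mesh_size divfK// pnatr_eq0.
rewrite /= in_itv /= /node -/dx; apply/andP; split.
  by rewrite lerDl; apply: mulr_ge0; [exact: ltW|apply: addr_ge0 => //; lra].
rewrite -lerBrDl -dxE; apply: ler_wpM2l; first exact: ltW.
by rewrite -[n.+1%:R]natr1; lra.
Qed.

Lemma node_interface k l : l = k.+1 :> nat ->
  node xi Bm Bp k ord_max = node xi Bm Bp l ord0.
Proof.
case: gll => -[xi0 xi1] _ _ _ _ lk.
by rewrite /node xi0 xi1 lk -[k.+1%:R]natr1; congr (_ + _ * _); field.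
Qed.

Lemma node_dist k i j : `|node xi Bm Bp k j - node xi Bm Bp k i| <= dx.
Proof.
have /andP[x0 x1] := xi_itv j; have /andP[y0 y1] := xi_itv i.
have -> : node xi Bm Bp k j - node xi Bm Bp k i = dx * ((xi j - xi i) / 2).
  by rewrite /node -/dx; field.
rewrite normrM gtr0_norm ?mesh_gt0//; apply: ler_piMr; first exact/ltW/mesh_gt0.
by rewrite ler_norml; apply/andP; split; lra.
Qed.

End Grid.

(** * Consistency of the scheme *)

Section Residual.
Variables (R : realType) (P : nat) (xi w : 'I_P.+1 -> R) (Bm Bp : R).

(* [V] stands for [dU/dt] and [Wd] for [dW/dt], so that [semidiscrete_eq] says that
   the residual vanishes; being linear in [(U, V, Wd)], it applies to the error. *)
Definition semidiscrete_residual (rg : regime) (K : nat) (a b : R -> R)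
    (U V Wd : 'cV[R]_(gsize K P)) : 'cV[R]_(gsize K P) :=
  let Hi := invmx (Hg w Bm Bp K) in
  let D := Dg xi w Bm Bp K in
  let B := Bhat R K P in
  let e1 := e_first R (gsize K P) in
  let eN := e_last R (gsize K P) in
  let am := nodal_diag xi Bm Bp K a in
  let bm := nodal_diag xi Bm Bp K b in
  let l1m := nodal_diag xi Bm Bp K (lambda1 a b) in
  let l2m := nodal_diag xi Bm Bp K (lambda2 a b) in
  let W := V - am *m Gmx rg xi w Bm Bp K *m U in
  let F := am *m W + bm *m D *m U in
  Wd - D *m F + 2^-1 *: (Hi *m B *m F)
  + Hi *m (- (2^-1 *: (D^T *m bm *m B)) + 4^-1 *: (B^T *m bm *m Hi *m B)) *m U
  - match rg with
    | c_pos =>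
      lambda2 a b Bm *: (Hi *m e1 *m e1^T *m (V - l1m *m D *m U))
      - lambda1 a b Bp *: (Hi *m eN *m eN^T *m (V - l2m *m D *m U))
    | c_neg =>
      - (Hi *m eN *m eN^T *m am *m W)
      - Hi *m (- (D^T *m bm *m eN *m eN^T) + eN *m eN^T *m bm *m Hi *m eN *m eN^T) *m U
    end.

End Residual.

Section Consistency.
Variables (R : realType) (P : nat) (xi w : 'I_P.+1 -> R) (Bm Bp : R) (n : nat).
Hypothesis gll : is_gll xi w.
Hypothesis BmBp : Bm < Bp.
Let K := n.+1.
Let N := gsize K P.
Let dx := mesh_size Bm Bp K.
Let X : set R := `[Bm, Bp]%classic.
Implicit Types (v : 'cV[R]_N) (k l : 'I_K) (i j : 'I_P.+1) (e M : R).

(** Crude maximum-norm bounds for reference differentiation and for the inverse weights; they do not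
    involve the mesh. *)
Definition diff_const : R :=
  \sum_i \sum_j `|((lagrange_poly xi j)^`()).[xi i]|.
Definition mass_const : R := \sum_j (w j)^-1.

(** A maximum-norm bound, insensitive to the growing dimension of the grid. *)
Definition entries_le v e : Prop := forall I, `|v I 0| <= e.

Let dx_gt0 : 0 < dx. Proof. exact: (mesh_gt0 n BmBp). Qed.
Let dx2_ge0 : 0 <= 2 / dx. Proof. by rewrite divr_ge0// ltW. Qed.

Lemma diff_const_ge0 : 0 <= diff_const.
Proof. by apply: sumr_ge0 => i _; apply: sumr_ge0. Qed.

Lemma mass_const_ge0 : 0 <= mass_const.
Proof. by apply: sumr_ge0 => j _; rewrite invr_ge0 ltW// (w_gt0 gll). Qed.

Lemma diff_row_le i : \sum_j `|((lagrange_poly xi j)^`()).[xi i]| <= diff_const.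
Proof.
rewrite /diff_const [leRHS](bigD1 i)//= lerDl.
by apply: sumr_ge0 => k _; apply: sumr_ge0.
Qed.

Lemma entries_le_ge0 v e : entries_le v e -> 0 <= e.
Proof. by move=> /(_ (gidx ord0 ord0)); exact: le_trans. Qed.

Lemma entries_leD v v' e e' : entries_le v e -> entries_le v' e' ->
  entries_le (v + v') (e + e').
Proof.
by move=> h h' I; rewrite v_entry (le_trans (ler_normD _ _))// lerD.
Qed.

Lemma entries_leN v e : entries_le v e -> entries_le (- v) e.
Proof. by move=> h I; rewrite v_entry normrN. Qed.

Lemma entries_leZ c v e : entries_le v e -> entries_le (c *: v) (`|c| * e).
Proof. by move=> h I; rewrite v_entry normrM ler_wpM2l. Qed.

Lemma entries_le_trans v e e' : e <= e' -> entries_le v e -> entries_le v e'.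
Proof. by move=> ee h I; exact: le_trans ee. Qed.

Lemma nodal_diag_entry (f : R -> R) v k j :
  (nodal_diag xi Bm Bp K f *m v) (gidx k j) 0 = f (node xi Bm Bp k j) * v (gidx k j) 0.
Proof. by rewrite /nodal_diag diag_entry mxE nodal_entry. Qed.

Lemma nodal_diag_le (f : R -> R) v M e : (forall x, X x -> `|f x| <= M) ->
  entries_le v e -> entries_le (nodal_diag xi Bm Bp K f *m v) (M * e).
Proof.
move=> fM ve I; have [k [j ->]] := gidxP I.
by rewrite nodal_diag_entry normrM ler_pM// fM//; exact: (node_itv gll BmBp).
Qed.

Lemma Dg_le v e : entries_le v e ->
  entries_le (Dg xi w Bm Bp K *m v) (2 / dx * (diff_const * e)).
Proof.
move=> ve I; have [k [i ->]] := gidxP I.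
rewrite (Dg_entry gll BmBp) normrM (ger0_norm dx2_ge0) ler_wpM2l//.
rewrite (le_trans (ler_norm_sum _ _ _))//.
apply: (@le_trans _ _ (\sum_j `|((lagrange_poly xi j)^`()).[xi i]| * e)).
  by apply: ler_sum => j _; rewrite normrM ler_wpM2l.
by rewrite -mulr_suml ler_wpM2r ?diff_row_le// (entries_le_ge0 ve).
Qed.

Lemma Hinv_entry v k j :
  (invmx (Hg w Bm Bp K) *m v) (gidx k j) 0 = 2 / dx * ((w j)^-1 * v (gidx k j) 0).
Proof.
rewrite (HgE _ _ _) inv_diag_entry; last exact: (hvec_gt0 gll BmBp).
rewrite hvec_entry -/dx.
have dx0 : dx != 0 by rewrite gt_eqF.
have w0 : w j != 0 by rewrite gt_eqF// (w_gt0 gll).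
by field; rewrite dx0 w0.
Qed.

Lemma Hinv_le v e : entries_le v e ->
  entries_le (invmx (Hg w Bm Bp K) *m v) (2 / dx * (mass_const * e)).
Proof.
move=> ve I; have [k [j ->]] := gidxP I.
have wj : 0 <= (w j)^-1 by rewrite invr_ge0 ltW// (w_gt0 gll).
rewrite Hinv_entry normrM (ger0_norm dx2_ge0) ler_wpM2l// normrM (ger0_norm wj).
apply: ler_pM => //; rewrite /mass_const [leRHS](bigD1 j)//= lerDl.
by apply: sumr_ge0 => i _; rewrite invr_ge0 ltW// (w_gt0 gll).
Qed.

(** A jump is at most [2 * e]. Ignoring the position inside the element, each element takes part in
    at most one interface on either side, whence 4. *)
Lemma Bhat_le v e : entries_le v e -> entries_le (Bhat R K P *m v) (4 * e).
Proof.
move=> ve I; have [m [j ->]] := gidxP I.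
have e0 := entries_le_ge0 ve.
rewrite Bhat_entry.
pose F (k : 'I_K) : R := (m == k)%:R.
apply: (@le_trans _ _ (\sum_(k < K) \sum_(l < K | l == k.+1 :> nat) (e + e) * (F k + F l))).
  rewrite (le_trans (ler_norm_sum _ _ _))//; apply: ler_sum => k _.
  rewrite (le_trans (ler_norm_sum _ _ _))//; apply: ler_sum => l _.
  rewrite normrM ler_pM//.
    by rewrite (le_trans (ler_normB _ _))// lerD.
  rewrite ger0_norm ?addr_ge0// lerD// ler_nat.
    by case: (m == k); case: (j == ord_max).
  by case: (m == l); case: (j == ord0).
have -> : \sum_(k < K) \sum_(l < K | l == k.+1 :> nat) (e + e) * (F k + F l) =
    (e + e) * (\sum_(k < K) \sum_(l < K | l == k.+1 :> nat) F k +
               \sum_(l < K) \sum_(k < K | l == k.+1 :> nat) F l).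
  rewrite [X in _ = _ * (_ + X)](exchange_big_dep xpredT)//= -big_split mulr_sumr /=.
  by apply: eq_bigr => k _; rewrite -big_split mulr_sumr.
have one : \sum_k F k = 1.
  by rewrite (bigD1 m)//= /F eqxx big1 ?addr0// => k km; rewrite eq_sym (negbTE km).
have -> : 4 * e = (e + e) * (1 + 1) by ring.
apply: ler_wpM2l; first by rewrite addr_ge0.
rewrite -one; apply: lerD; apply: ler_sum => k _.
  by rewrite sum_succ; case: eqP; rewrite /F.
by rewrite sum_pred; case: eqP; rewrite /F.
Qed.

Lemma Dtilde_le v e : entries_le v e ->
  entries_le (Dtilde xi w Bm Bp K *m v) (2 / dx * ((diff_const + 2 * mass_const) * e)).
Proof.
move=> ve; rewrite Dtilde_mul.
have := entries_leD (Dg_le ve) (entries_leN (entries_leZ 2^-1 (Hinv_le (Bhat_le ve)))).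
apply: entries_le_trans; rewrite ger0_norm//.
by rewrite le_eqVlt; apply/orP; left; apply/eqP; field; rewrite gt_eqF.
Qed.

(** The two copies of an interface node carry the same value. *)
Lemma Bhat_nodal (f : R -> R) : Bhat R K P *m nodal xi Bm Bp K f = 0.
Proof.
rewrite Bhat_mul; apply: big1 => k _; apply: big1 => l /eqP lk.
by rewrite !nodal_entry (node_interface _ _ gll lk) subrr scale0r.
Qed.

Lemma bounded_Ck_ge0 m M (f : R -> R) : bounded_Ck X m M f -> 0 <= M.
Proof.
move=> fM; apply: le_trans (bounded_Ck_sup fM (_ : X Bm)) => //.
by rewrite /X /= in_itv /= lexx ltW.
Qed.

(** [D] is exact on polynomials of degree [P]. Against the Taylor polynomial at the node, the data
    of the element are off by [M * dx ^+ P.+1] and the derivative at the node not at all;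
    differentiation costs [2 / dx]. *)
Lemma Dg_nodal M (f : R -> R) : bounded_Ck X P.+1 M f ->
  entries_le (Dg xi w Bm Bp K *m nodal xi Bm Bp K f - nodal xi Bm Bp K (deriv_on X f))
    (2 * diff_const * M * dx ^+ P).
Proof.
move=> fM I; have [k [i ->]] := gidxP I.
have M0 := bounded_Ck_ge0 fM.
pose x0 := node xi Bm Bp k i.
have Xx0 : X x0 by exact: (node_itv gll BmBp).
have [p pP pE] := taylor_poly fM Xx0.
have dx0 : dx != 0 by rewrite gt_eqF.
have d0 : deriv_on X f x0 = (p^`()).[x0].
  have [_] := pE _ Xx0; rewrite subrr normr0 expr0n (gtn_eqF (gll_order_gt0 gll)) mulr0.
  by rewrite normr_le0 subr_eq0 => /eqP.
have exact_p : 2 / dx * \sum_j ((lagrange_poly xi j)^`()).[xi i] * p.[node xi Bm Bp k j]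
    = (p^`()).[x0].
  (* The affine map from the reference element to the physical one, sending [xi i] to [x0];
     composition with it preserves the degree bound. *)
  pose lin : {poly R} := (dx / 2) *: 'X + (x0 - dx / 2 * xi i)%:P.
  pose q : {poly R} := p \Po lin.
  have qE z : q.[z] = p.[x0 + dx / 2 * (z - xi i)].
    by rewrite horner_comp hornerD hornerZ hornerX hornerC; congr (p.[_]); ring.
  have sq : (size q <= P.+1)%N.
    have s2 : (size lin <= 2)%N.
      rewrite /lin (leq_trans (size_polyD _ _))// geq_max.
      rewrite (leq_trans (size_scale_leq _ _)) ?size_polyX//=.
      by rewrite (leq_trans (size_polyC_leq1 _)).
    rewrite /q; have [->|p0] := eqVneq p 0; first by rewrite comp_poly0 size_poly0.
    rewrite (leq_trans (size_comp_poly_leq _ _))// ltnS.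
    apply: (@leq_trans ((size p).-1 * 1)%N).
      by rewrite leq_mul2l; apply/orP; right; move: s2; case: size.
    by rewrite muln1; move: pP; case: size.
  have := sum_lagrange_deriv gll (xi i) sq.
  have dlin : lin^`() = (dx / 2)%:P.
    by rewrite /lin derivD derivZ derivX derivC addr0 alg_polyC.
  have lin0 : lin.[xi i] = x0 by rewrite /lin hornerD hornerZ hornerX hornerC; ring.
  rewrite {2}/q deriv_comp hornerM horner_comp lin0 dlin hornerC => h.
  have -> : \sum_j ((lagrange_poly xi j)^`()).[xi i] * p.[node xi Bm Bp k j] =
      (p^`()).[x0] * (dx / 2).
    rewrite -h; apply: eq_bigr => j _; congr (_ * _); rewrite qE; congr (p.[_]).
    by rewrite /x0 /node -/dx; field.
  by field.
rewrite v_entry (Dg_entry gll BmBp) -/dx v_entry nodal_entry -/x0 d0 -exact_p.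
rewrite -mulrBr -sumrB normrM (ger0_norm dx2_ge0).
have -> : 2 * diff_const * M * dx ^+ P = 2 / dx * (diff_const * (M * dx ^+ P.+1)).
  by rewrite exprS; field.
rewrite ler_wpM2l// (le_trans (ler_norm_sum _ _ _))//.
apply: (@le_trans _ _ (\sum_j `|((lagrange_poly xi j)^`()).[xi i]| * (M * dx ^+ P.+1))).
  apply: ler_sum => j _; rewrite nodal_entry -mulrBr normrM ler_wpM2l//.
  have [h _] := pE _ (node_itv gll BmBp k j); apply: le_trans h _.
  rewrite ler_wpM2l// lerXn2r ?nnegrE ?(ltW dx_gt0)//.
  exact: (node_dist gll BmBp).
rewrite -mulr_suml ler_wpM2r ?diff_row_le// mulr_ge0// exprn_ge0// ltW//.
Qed.

Let i1 : 'I_N := gidx ord0 ord0.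
Let iN : 'I_N := gidx ord_max ord_max.

Lemma nodal_first (f : R -> R) : nodal xi Bm Bp K f i1 0 = f Bm.
Proof. by rewrite nodal_entry (node_first _ _ _ gll). Qed.

Lemma nodal_last (f : R -> R) : nodal xi Bm Bp K f iN 0 = f Bp.
Proof. by rewrite nodal_entry (node_last _ _ _ gll). Qed.

(** On nodal values the interface correction sees no jump, and the boundary correction of [Dhat]
    sees only the value at [Bp]. *)
Lemma Gmx_nodal rg (f : R -> R) : (rg = c_neg -> f Bp = 0) ->
  Gmx rg xi w Bm Bp K *m nodal xi Bm Bp K f = Dg xi w Bm Bp K *m nodal xi Bm Bp K f.
Proof.
have Dt : Dtilde xi w Bm Bp K *m nodal xi Bm Bp K f = Dg xi w Bm Bp K *m nodal xi Bm Bp K f.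
  by rewrite Dtilde_mul Bhat_nodal mulmx0 scaler0 subr0.
case: rg => //= /(_ erefl) f0; rewrite /Dhat mulmxBl Dt e_lastE -!mulmxA delta_outer.
by rewrite nodal_last f0 scale0r mulmx0 subr0.
Qed.

Lemma boundary_term_le (c y : R) (I : 'I_N) e : `|c * y| <= e ->
  entries_le (invmx (Hg w Bm Bp K) *m (c *: (y *: delta_mx I 0))) (2 / dx * (mass_const * e)).
Proof.
move=> ce; apply: Hinv_le => J; rewrite scalerA v_entry normrM.
apply: le_trans ce; rewrite ler_piMr// mxE; case: (_ && _); by rewrite ?normr0 ?normr1.
Qed.

(** The first summand collects the errors of full order, one factor [dx] being bounded by the length
    of the domain. The second collects the flux discrepancy after division by [dx], in the volume
    and at the boundary. *)
Definition truncation_const (Ma Mb Mf Mg Mphi : R) : R :=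
  (Bp - Bm) * (2 * diff_const * (Ma * Mg + Mphi))
  + 4 * (diff_const + 4 * mass_const) * (Ma ^+ 2 + Mb) * diff_const * Mf.

(** To be read with [f], [g], [z] the slices of [u], [u_t], [u_tt] at a fixed time, and [phi] the
    exact flux. *)
Lemma truncation_bound rg (a b f g z : R -> R) (Ma Mb Mf Mg Mphi : R) :
  let fx := deriv_on X f in
  let phi := fun x => a x * (g x - a x * fx x) + b x * fx x in
  (forall x, X x -> `|a x| <= Ma) -> (forall x, X x -> 0 <= b x <= Mb) ->
  bounded_Ck X P.+1 Mf f -> bounded_Ck X P.+1 Mg g -> bounded_Ck X P.+1 Mphi phi ->
  (forall x, X x -> z x - a x * deriv_on X g x = deriv_on X phi x) ->
  match rg with
  | c_pos => g Bm = lambda1 a b Bm * fx Bm /\ g Bp = lambda2 a b Bp * fx Bp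
  | c_neg => [/\ f Bp = 0, g Bp = 0 & fx Bp = 0]
  end ->
  entries_le
    (semidiscrete_residual xi w Bm Bp rg a b (nodal xi Bm Bp K f) (nodal xi Bm Bp K g)
      (nodal xi Bm Bp K z - nodal_diag xi Bm Bp K a *m Gmx rg xi w Bm Bp K *m nodal xi Bm Bp K g))
    (truncation_const Ma Mb Mf Mg Mphi * dx ^+ P.-1).
Proof.
move=> fx phi aM bM fC gC phiC pde bc.
set U := nodal xi Bm Bp K f; set V := nodal xi Bm Bp K g.
set am := nodal_diag xi Bm Bp K a; set bm := nodal_diag xi Bm Bp K b.
set D := Dg xi w Bm Bp K; set Hi := invmx (Hg w Bm Bp K).
have GU : Gmx rg xi w Bm Bp K *m U = D *m U.
  by apply: Gmx_nodal => rgE; move: bc; rewrite rgE => -[].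
have GV : Gmx rg xi w Bm Bp K *m V = D *m V.
  by apply: Gmx_nodal => rgE; move: bc; rewrite rgE => -[].
have BU : Bhat R K P *m U = 0 by exact: Bhat_nodal.
rewrite /semidiscrete_residual -/am -/bm -/D -/Hi -(mulmxA am) GV -(mulmxA am) GU.
set W := V - am *m (D *m U); set F := am *m W + _.
have XBm : X Bm by rewrite /X /= in_itv /= lexx ltW.
have XBp : X Bp by rewrite /X /= in_itv /= lexx ltW.
have Ma0 : 0 <= Ma by exact: le_trans (aM _ XBm).
have Mb0 : 0 <= Mb by have /andP[/le_trans h /h] := bM _ XBm.
have Mf0 := bounded_Ck_ge0 fC.
pose L := Ma ^+ 2 + Mb.
have L0 : 0 <= L by rewrite addr_ge0 ?sqr_ge0.
have a2M x : X x -> `|a x * a x| <= Ma ^+ 2.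
  by move=> Xx; rewrite normrM expr2 ler_pM ?aM.
pose ef := 2 * diff_const * Mf * dx ^+ P.
pose rf := D *m U - nodal xi Bm Bp K fx.
pose rg' := D *m V - nodal xi Bm Bp K (deriv_on X g).
pose rphi := D *m nodal xi Bm Bp K phi - nodal xi Bm Bp K (deriv_on X phi).
have rfE : entries_le rf ef by exact: Dg_nodal.
have rgE : entries_le rg' (2 * diff_const * Mg * dx ^+ P) by exact: Dg_nodal.
have rphiE : entries_le rphi (2 * diff_const * Mphi * dx ^+ P) by exact: Dg_nodal.
have ef0 := entries_le_ge0 rfE.
(* The discrepancy between discrete and exact flux: [(b - a ^ 2)] times the error of [D U], which
   enters once through [W] and once directly. *)
pose r := bm *m rf - am *m (am *m rf).
have rE : entries_le r (L * ef).
  have bM' x : X x -> `|b x| <= Mb by move=> /bM/andP[? ?]; rewrite ger0_norm.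
  have := entries_leD (nodal_diag_le bM' rfE)
    (entries_leN (nodal_diag_le aM (nodal_diag_le aM rfE))).
  by apply: entries_le_trans; rewrite /L; lra.
have FE : F = nodal xi Bm Bp K phi + r.
  have DU : D *m U = nodal xi Bm Bp K fx + rf by rewrite /rf addrC subrK.
  apply/colP => I; have [k [j ->]] := gidxP I.
  rewrite /F /W /r -(mulmxA bm) DU /am /bm.
  rewrite !(v_entry, nodal_diag_entry, nodal_entry).
  by rewrite /phi /V ?nodal_entry; ring.
clearbody r.
set Rb := (X in entries_le (_ - X) _).
(* The penalties vanish on [U], the exact flux has no jumps, and the equation cancels the leading
   terms; only [r] meets the corrected operator. *)
have -> : nodal xi Bm Bp K z - am *m (D *m V) - D *m F + 2^-1 *: (Hi *m Bhat R K P *m F)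
    + Hi *m (- (2^-1 *: (D^T *m bm *m Bhat R K P))
             + 4^-1 *: ((Bhat R K P)^T *m bm *m Hi *m Bhat R K P)) *m U - Rb =
    - (am *m rg') - rphi - Dtilde xi w Bm Bp K *m r - Rb.
  congr (_ - Rb).
  have -> : Hi *m (- (2^-1 *: (D^T *m bm *m Bhat R K P))
      + 4^-1 *: ((Bhat R K P)^T *m bm *m Hi *m Bhat R K P)) *m U = 0.
    rewrite -mulmxA mulmxDl mulNmx -!scalemxAl -!mulmxA BU.
    by rewrite !mulmx0 !scaler0 oppr0 addr0 mulmx0.
  rewrite addr0 FE -(mulmxA Hi) !(mulmxDr _ _ r) Bhat_nodal add0r Dtilde_mul -/Hi -/D.
  have := pde; rewrite /rphi /rg'.
  move=> pde'; apply/colP => I; have [k [j IE]] := gidxP I.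
  rewrite mulmxBr !v_entry; set A1 := (D *m r) I 0; set A2 := (Hi *m _) I 0.
  set A3 := (am *m (D *m V)) I 0; set A4 := (D *m _) I 0.
  rewrite IE !nodal_diag_entry !nodal_entry -pde'; last exact: (node_itv gll BmBp).
  by ring.
have RbE : entries_le Rb (2 * (2 / dx * (mass_const * (L * ef)))).
  have twice (v v' : 'cV[R]_N) (t : R) : entries_le v t -> entries_le v' t ->
      entries_le (v - v') (2 * t).
    by move=> hv hv'; rewrite mulr_natl mulr2n; apply: entries_leD => //; exact: entries_leN.
  have DUe I : (D *m U) I 0 = nodal xi Bm Bp K fx I 0 + rf I 0.
    by rewrite /rf !v_entry addrC subrK.
  (* After the boundary condition is used, each boundary term is this product times the error of
     [D U] there, so it is bounded by [L * ef]. *)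
  have l12 x : X x -> lambda2 a b x * lambda1 a b x = a x * a x - b x.
    move=> /bM/andP[b0 _]; rewrite /lambda1 /lambda2.
    by have := sqr_sqrtr b0; rewrite expr2 => sq; rewrite -[b x in RHS]sq; ring.
  have lL x : X x -> `|lambda2 a b x * lambda1 a b x| <= L.
    move=> Xx; rewrite (l12 _ Xx) (le_trans (ler_normB _ _))// lerD ?a2M//.
    by have /andP[? ?] := bM _ Xx; rewrite ger0_norm.
  rewrite /Rb; case: (rg) bc => /=.
    move=> [bc1 bcN]; apply: twice.
      rewrite e_firstE -!mulmxA delta_outer scalemxAr.
      apply: boundary_term_le.
      rewrite !v_entry /V nodal_diag_entry -/i1 DUe nodal_first [nodal _ _ _ _ _ _ _]nodal_first.
      rewrite (node_first _ _ _ gll) bc1.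
      have -> : lambda2 a b Bm * (lambda1 a b Bm * fx Bm - lambda1 a b Bm * (fx Bm + rf i1 0))
         = - (lambda2 a b Bm * lambda1 a b Bm * rf i1 0) by ring.
      by rewrite normrN normrM ler_pM// lL.
    rewrite e_lastE -!mulmxA delta_outer scalemxAr; apply: boundary_term_le.
    rewrite !v_entry /V nodal_diag_entry -/iN DUe nodal_last [nodal _ _ _ _ _ _ _]nodal_last.
    rewrite (node_last _ _ _ gll) bcN.
    have -> : lambda1 a b Bp * (lambda2 a b Bp * fx Bp - lambda2 a b Bp * (fx Bp + rf iN 0))
       = - (lambda2 a b Bp * lambda1 a b Bp * rf iN 0) by ring.
    by rewrite normrN normrM ler_pM// lL.
  move=> [f0 g0 fx0]; rewrite e_lastE.
  have eU : (delta_mx iN 0 : 'cV[R]_N)^T *m U = 0.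
    by apply/colP => I; rewrite trmx_delta -rowE mxE [RHS]mxE nodal_last.
  rewrite -(mulmxA Hi _ U) mulmxDl mulNmx -!mulmxA eU !mulmx0 oppr0 addr0 mulmx0 subr0.
  apply: entries_leN; rewrite delta_outer -[_ *: delta_mx _ _]scale1r.
  (* A single boundary term survives here; it is enlarged to the bound for the two terms of the
     other regime. *)
  apply: (@entries_le_trans _ (2 / dx * (mass_const * (L * ef)))).
    rewrite ler_peMl ?ler1n// mulr_ge0// mulr_ge0 ?mass_const_ge0//.
    by rewrite mulr_ge0.
  apply: boundary_term_le; rewrite mul1r nodal_diag_entry (node_last _ _ _ gll) /W !v_entry.
  rewrite nodal_diag_entry -/iN (node_last _ _ _ gll) DUe /V !nodal_last g0 fx0.
  have -> : a Bp * (0 - a Bp * (0 + rf iN 0)) = - (a Bp * a Bp * rf iN 0) by ring.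
  by rewrite normrN normrM ler_pM// (le_trans (a2M _ XBp))// /L lerDl.
have := entries_leD (entries_leD (entries_leD (entries_leN (nodal_diag_le aM rgE))
  (entries_leN rphiE)) (entries_leN (Dtilde_le rE))) (entries_leN RbE).
apply: entries_le_trans.
have dxP : dx ^+ P = dx * dx ^+ P.-1 by rewrite -exprS prednK// (gll_order_gt0 gll).
have dx0 : dx != 0 by rewrite gt_eqF.
have dxl : dx <= Bp - Bm by exact: (mesh_le n BmBp).
have -> : Ma * (2 * diff_const * Mg * dx ^+ P) + 2 * diff_const * Mphi * dx ^+ P
    + 2 / dx * ((diff_const + 2 * mass_const) * (L * ef))
    + 2 * (2 / dx * (mass_const * (L * ef))) =
    (dx * (2 * diff_const * (Ma * Mg + Mphi))
     + 4 * (diff_const + 4 * mass_const) * L * diff_const * Mf) * dx ^+ P.-1.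
  by rewrite /ef dxP; field.
rewrite ler_wpM2r ?exprn_ge0 ?(ltW dx_gt0)// lerD2r ler_wpM2r//.
rewrite mulr_ge0 ?mulr_ge0 ?diff_const_ge0// addr_ge0 ?(bounded_Ck_ge0 phiC)//.
by rewrite mulr_ge0// (bounded_Ck_ge0 gC).
Qed.

End Consistency.

(** * Growth of the energy in time *)

Section TimeEnergy.
Variable R : realType.

Lemma is_deriv_on_mulmx (N : nat) (S : set R) (M : 'M[R]_N) (x : R -> 'cV[R]_N) s (x' : 'cV[R]_N) :
  (forall i, is_deriv_on S (fun r => x r i 0) s (x' i 0)) ->
  forall i, is_deriv_on S (fun r => (M *m x r) i 0) s ((M *m x') i 0).
Proof.
move=> xd i; rewrite mxE; under eq_fun do rewrite mxE.
by apply: is_deriv_on_sum => j; exact: is_deriv_onZ.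
Qed.

Lemma is_deriv_on_wprod (N : nat) (S : set R) (h : 'cV[R]_N) (x y : R -> 'cV[R]_N) s
    (x' y' : 'cV[R]_N) :
  (forall i, is_deriv_on S (fun r => x r i 0) s (x' i 0)) ->
  (forall i, is_deriv_on S (fun r => y r i 0) s (y' i 0)) ->
  is_deriv_on S (fun r => wprod h (x r) (y r)) s (wprod h x' (y s) + wprod h (x s) y').
Proof.
move=> xd yd; rewrite /wprod -big_split /=; apply: is_deriv_on_sum => i.
by rewrite -mulrDr; apply: is_deriv_onZ; exact: is_deriv_onM.
Qed.

(* Avoids the exponential of Gronwall's lemma: the mean value theorem is applied
   between [0] and the maximum of [g], where the linear term costs only half of it. *)
Lemma quadratic_growth_bound (t m : R) (g g' : R -> R) : 0 < t -> 0 <= m ->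
  (forall s, `[0, t]%classic s -> is_deriv_on `[0, t] g s (g' s)) ->
  g 0 = 0 ->
  (forall s, `[0, t]%classic s -> g' s <= (2 * t)^-1 * g s + 2 * t * m) ->
  g t <= 4 * t ^+ 2 * m.
Proof.
move=> t0 m0 gd g0 g'le.
have [c cI cmax] := EVT_max (ltW t0) (is_deriv_on_cont gd).
have I0 : 0 \in `[0, t]%R by rewrite in_itv /= lexx ltW.
have It : t \in `[0, t]%R by rewrite in_itv /= lexx ltW.
move: (cI); rewrite in_itv /= => /andP[c0 ct].
apply: le_trans (cmax _ It) _.
have gc0 : 0 <= g c by rewrite -g0 cmax.
have [z /andP[z0 zc]] := MVT_on gd (lexx 0) c0 ct.
rewrite g0 !subr0 => gcE.
have zI : z \in `[0, t]%R by rewrite in_itv /= z0 (le_trans zc ct).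
have ti : 0 < (2 * t)^-1 by rewrite invr_gt0 mulr_gt0.
have h1 : g' z <= (2 * t)^-1 * g c + 2 * t * m.
  by apply: le_trans (g'le _ zI) _; rewrite lerD2r ler_pM2l// cmax.
have h2 : 0 <= (2 * t)^-1 * g c + 2 * t * m.
  apply: addr_ge0; first by apply: mulr_ge0 => //; exact: ltW.
  by apply: mulr_ge0 => //; apply: mulr_ge0 => //; exact: ltW.
have h3 : g c <= ((2 * t)^-1 * g c + 2 * t * m) * t.
  rewrite {1}gcE; apply: (@le_trans _ _ (((2 * t)^-1 * g c + 2 * t * m) * c)).
    exact: ler_wpM2r.
  exact: ler_wpM2l.
have e : ((2 * t)^-1 * g c + 2 * t * m) * t = g c / 2 + 2 * t ^+ 2 * m.
  by field; rewrite gt_eqF.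
by rewrite e in h3; lra.
Qed.

Lemma quadratic_formE (N : nat) (h : 'cV[R]_N) (d : 'rV[R]_N) (M : 'M[R]_N) (x : 'cV[R]_N) :
  (x^T *m (M^T *m diag_mx d *m diag_mx h^T *m M) *m x) 0 0 =
  wprod h (M *m x) (diag_mx d *m (M *m x)).
Proof.
rewrite -wprodE trmx_mul; congr (_ 0 0).
have -> : M^T *m diag_mx d *m diag_mx h^T = M^T *m diag_mx h^T *m diag_mx d.
  by rewrite -!mulmxA !mulmx_diag; congr (_ *m diag_mx _); apply/rowP => i; rewrite !mxE mulrC.
by rewrite !mulmxA.
Qed.

Variables (P : nat) (xi w : 'I_P.+1 -> R) (Bm Bp : R) (n : nat).
Hypothesis gll : is_gll xi w.
Hypothesis BmBp : Bm < Bp.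
Let K := n.+1.
Let N := gsize K P.
Variables (rg : regime) (a b : R -> R).
Let X : set R := `[Bm, Bp]%classic.
Hypothesis ab_hyp : coeff_hyp rg X a b.
Let h : 'cV[R]_N := hvec w Bm Bp n.
Let G := Gmx rg xi w Bm Bp K.
Let am := nodal_diag xi Bm Bp K a.
Let kappa := match rg with c_pos => cfun a b | c_neg => b end.
Let km := nodal_diag xi Bm Bp K kappa.
Implicit Types U V Wd : 'cV[R]_N.

Definition energy_velocity U V : 'cV[R]_N :=
  match rg with c_pos => V | c_neg => V - am *m G *m U end.

(** The time derivative of the energy velocity. When that is [V], it is recovered from
    [Wd = dV/dt - am G V]. *)
Let energy_acceleration V Wd : 'cV[R]_N :=
  match rg with c_pos => Wd + am *m G *m V | c_neg => Wd end.

Lemma coeff_ge0 x : X x -> 0 <= b x /\ 0 <= kappa x.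
Proof.
move: ab_hyp; rewrite /kappa; case: rg => /=.
  by move=> [_ _ bc] /bc[b0 c0]; split; exact: ltW.
by move=> [a0 [b0 [_ b0_gt0 _ abE]]] /abE[_ ->]; split; exact: ltW.
Qed.

Lemma energy_rate_le U V Wd :
  wprod h (energy_velocity U V) (energy_acceleration V Wd)
  + wprod h (G *m U) (km *m (G *m V)) <=
  wprod h (energy_velocity U V) (semidiscrete_residual xi w Bm Bp rg a b U V Wd).
Proof.
have h0 : forall i, 0 < h i 0 by exact: hvec_gt0 gll BmBp.
have B1 := @Bhat_first _ _ _ _ n gll; have BN := @Bhat_last _ _ _ _ n gll.
have XBm : X Bm by rewrite /X /= in_itv /= lexx ltW.
have XBp : X Bp by rewrite /X /= in_itv /= lexx ltW.
pose Dt := Dg xi w Bm Bp K - 2^-1 *: (invmx (diag_mx h^T) *m Bhat R K P).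
have DtE : Dtilde xi w Bm Bp K = Dt by rewrite /Dt -HgE.
have sbp : forall x y, wprod h x (Dt *m y) + wprod h y (Dt *m x) =
    x (gidx ord_max ord_max) 0 * y (gidx ord_max ord_max) 0
    - x (gidx ord0 ord0) 0 * y (gidx ord0 ord0) 0.
  by rewrite -DtE; exact: Dtilde_sbp.
have bge0 := fun x Xx => (@coeff_ge0 x Xx).1.
move: ab_hyp bge0; rewrite /semidiscrete_residual /energy_velocity.
rewrite /energy_acceleration /G /km /kappa.
rewrite e_firstE e_lastE (HgE w Bm Bp n) -/h.
case: (rg) => /=.
  move=> _ bge0.
  have kE : nodal_diag xi Bm Bp K (cfun a b) =
      diag_mx (\row_i ((nodal xi Bm Bp K b)^T 0 i - (nodal xi Bm Bp K a)^T 0 i ^+ 2)).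
    congr diag_mx; apply/rowP => i; rewrite [RHS]mxE ![_^T _ _]mxE.
    by have [k [j ->]] := gidxP i; rewrite !nodal_entry.
  have := energy_identity_pos h0 sbp B1 BN (a := (nodal xi Bm Bp K a)^T)
    (b := (nodal xi Bm Bp K b)^T) U V Wd (l1 := (nodal xi Bm Bp K (lambda1 a b))^T)
    (l2 := (nodal xi Bm Bp K (lambda2 a b))^T) (k1 := Num.sqrt (b Bm)) (kN := Num.sqrt (b Bp)).
  have trE (f : R -> R) i : (nodal xi Bm Bp K f)^T 0 i = nodal xi Bm Bp K f i 0 by rewrite mxE.
  rewrite !trE !(nodal_first _ _ _ gll) !(nodal_last _ _ _ gll) !sqr_sqrtr ?bge0//.
  move=> /(_ erefl erefl erefl erefl erefl erefl).
  rewrite -/Dt -DtE -kE => ->.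
  (* The boundary squares, weighted by the square root of [b], are dropped. *)
  rewrite -addrA lerDl addr_ge0// mulr_ge0 ?sqrtr_ge0 ?sqr_ge0//.
move=> [a0 [b0 [a0_gt0 b0_gt0 c0 abE]]] _.
have aE i : (nodal xi Bm Bp K a)^T 0 i = a0.
  rewrite mxE; have [k [j ->]] := gidxP i; rewrite nodal_entry.
  by case: (abE _ (node_itv gll BmBp k j)).
have bE i : (nodal xi Bm Bp K b)^T 0 i = b0.
  rewrite mxE; have [k [j ->]] := gidxP i; rewrite nodal_entry.
  by case: (abE _ (node_itv gll BmBp k j)).
have := energy_inequality_neg h0 (first_neq_last n gll) sbp B1 BN (U := U) (V := V) Wd
  aE bE a0_gt0 b0_gt0 c0.
by move=> /(_ _ erefl); rewrite -/Dt -DtE /Dhat e_lastE (HgE w Bm Bp n).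
Qed.

Definition energy U V : R :=
  wprod h (energy_velocity U V) (energy_velocity U V) + wprod h (G *m U) (km *m (G *m U)).

(** The total weight does not depend on the number of elements, so maximum-norm bounds become
    [H]-norm bounds uniformly in the mesh. *)
Lemma sum_hvec : \sum_i h i 0 = (Bp - Bm) / 2 * \sum_j w j.
Proof.
rewrite sum_gidx.
under eq_bigr do under eq_bigr do rewrite hvec_entry.
under eq_bigr do rewrite -mulr_sumr.
rewrite sumr_const card_ord /mesh_size /K -[LHS]mulr_natl.
have : n.+1%:R != 0 :> R by rewrite pnatr_eq0.
by move: (n.+1%:R) => k k0; field.
Qed.

Lemma wprod_entries_le (x : 'cV[R]_N) e : entries_le x e ->
  wprod h x x <= (Bp - Bm) / 2 * (\sum_j w j) * e ^+ 2.
Proof.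
move=> xe; rewrite -sum_hvec mulr_suml; apply: ler_sum => i _.
apply: ler_wpM2l; first exact/ltW/(hvec_gt0 gll BmBp).
rewrite -expr2 -real_normK ?num_real// lerXn2r ?nnegrE//.
exact: entries_le_ge0 xe.
Qed.

(** The derivative of the energy is at most twice the product of velocity and residual. Young's
    inequality with weight [(2 * t)^-1] brings this to the form required by
    [quadratic_growth_bound], and the square root of [4 * t ^+ 2 * S * e ^+ 2] is the stated
    bound. *)
Lemma energy_bound (t e : R) (U V Wd : R -> 'cV[R]_N) : 0 < t ->
  (forall s, `[0, t]%classic s -> forall i, is_deriv_on `[0, t] (fun r => U r i 0) s (V s i 0)) ->
  (forall s, `[0, t]%classic s -> forall i,
     is_deriv_on `[0, t] (fun r => (V r - am *m G *m U r) i 0) s (Wd s i 0)) ->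
  U 0 = 0 -> V 0 = 0 ->
  (forall s, `[0, t]%classic s ->
     entries_le (semidiscrete_residual xi w Bm Bp rg a b (U s) (V s) (Wd s)) e) ->
  Num.sqrt (energy (U t) (V t)) <= 2 * t * Num.sqrt ((Bp - Bm) / 2 * (\sum_j w j)) * e.
Proof.
move=> t0 Ud Wdd U0 V0 res.
have It : `[0, t]%classic t by rewrite /= in_itv /= lexx ltW.
have e0 : 0 <= e by exact: entries_le_ge0 (res _ It).
have h0 : forall i, 0 <= h i 0 by move=> i; apply/ltW/(hvec_gt0 gll BmBp).
pose S := (Bp - Bm) / 2 * (\sum_j w j).
have S0 : 0 <= S.
  rewrite mulr_ge0 ?divr_ge0 ?subr_ge0 ?(ltW BmBp)//; apply: sumr_ge0 => j _.
  exact/ltW/(w_gt0 gll).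
pose Ew s := energy_velocity (U s) (V s); pose Ew' s := energy_acceleration (V s) (Wd s).
pose g s := energy (U s) (V s).
pose g' s := 2 * (wprod h (Ew s) (Ew' s) + wprod h (G *m U s) (km *m (G *m V s))).
have Gd s : `[0, t]%classic s -> forall i,
    is_deriv_on `[0, t] (fun r => (am *m G *m U r) i 0) s ((am *m G *m V s) i 0).
  by move=> sI; apply: is_deriv_on_mulmx; exact: Ud.
have Ewd s : `[0, t]%classic s -> forall i, is_deriv_on `[0, t] (fun r => Ew r i 0) s (Ew' s i 0).
  move=> sI i; have := Wdd _ sI i; have := Gd _ sI i.
  rewrite /Ew /Ew' /energy_velocity /energy_acceleration; case: (rg) => // d1 d2.
  (* Differentiability is given for [V - am G U]; that of [V] follows by adding [am G U] back. *)
  have := is_deriv_onD d2 d1; rewrite v_entry.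
  by apply: is_deriv_on_ext => // r _; rewrite !v_entry subrK.
have gd s : `[0, t]%classic s -> is_deriv_on `[0, t] g s (g' s).
  move=> sI; have GUd := is_deriv_on_mulmx (M := G) (Ud s sI).
  have := is_deriv_onD (is_deriv_on_wprod (h := h) (Ewd s sI) (Ewd s sI))
    (is_deriv_on_wprod (h := h) GUd (is_deriv_on_mulmx (M := km) GUd)).
  rewrite -[wprod h (G *m V s) _]wprod_diagC (wprodC _ (Ew' s)) (wprodC _ (km *m _)).
  by congr is_deriv_on; rewrite /g'; ring.
have g0 : g 0 = 0.
  rewrite /g /energy /energy_velocity U0 V0 !mulmx0 subr0.
  by case: (rg); rewrite /wprod !big1 ?addr0// => i _; rewrite !mxE mul0r mulr0.
have g'le s : `[0, t]%classic s -> g' s <= (2 * t)^-1 * g s + 2 * t * (S * e ^+ 2).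
  move=> sI; rewrite /g'.
  have k0 : 0 < (2 * t)^-1 by rewrite invr_gt0 mulr_gt0.
  have := energy_rate_le (U s) (V s) (Wd s); rewrite -/(Ew s) -/(Ew' s).
  have := wprod_young (Ew s) (semidiscrete_residual xi w Bm Bp rg a b (U s) (V s) (Wd s)) h0 k0.
  have := wprod_entries_le (res s sI); rewrite invrK -/S.
  have GU0 : 0 <= wprod h (G *m U s) (km *m (G *m U s)).
    apply: sumr_ge0 => i _; have [k [j ->]] := gidxP i.
    rewrite nodal_diag_entry mulr_ge0// mulrCA -expr2 mulr_ge0 ?sqr_ge0//.
    by have [] := coeff_ge0 (node_itv gll BmBp k j).
  have gE : g s = wprod h (Ew s) (Ew s) + wprod h (G *m U s) (km *m (G *m U s)) by [].
  move=> i1 i2 i3; rewrite gE mulrDr.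
  have p1 := mulr_ge0 (ltW k0) GU0.
  have p2 := ler_wpM2l (ltW (mulr_gt0 (ltr0Sn R 1) t0)) i1.
  by lra.
have := quadratic_growth_bound t0 (mulr_ge0 S0 (sqr_ge0 e)) gd g0 g'le.
rewrite /g => gt.
have -> : 2 * t * Num.sqrt S * e = Num.sqrt (4 * t ^+ 2 * (S * e ^+ 2)).
  have -> : 4 * t ^+ 2 * (S * e ^+ 2) = S * (2 * t * e) ^+ 2 by ring.
  rewrite [in RHS]sqrtrM// sqrtr_sqr ger0_norm; first by ring.
  by apply: mulr_ge0 => //; apply: mulr_ge0 => //; exact: ltW.
exact: ler_wsqrtr.
Qed.

Lemma semidiscrete_residualB U V Wd U' V' Wd' :
  semidiscrete_residual xi w Bm Bp rg a b (U - U') (V - V') (Wd - Wd') =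
  semidiscrete_residual xi w Bm Bp rg a b U V Wd -
  semidiscrete_residual xi w Bm Bp rg a b U' V' Wd'.
Proof.
rewrite /semidiscrete_residual; case: (rg); apply/colP => i;
by rewrite !(mulmxDr, mulmxN, scalerDr, scalerN, opprD, opprK) !v_entry; ring.
Qed.

End TimeEnergy.

(** * The error estimate *)

Lemma coeff_bounded (R : realType) (rg : regime) (Bm Bp : R) (a b : R -> R) (m : nat) :
  Bm < Bp -> coeff_hyp rg `[Bm, Bp] a b ->
  exists Ma Mb : R, bounded_Ck `[Bm, Bp] m Ma a /\ bounded_Ck `[Bm, Bp] m Mb b.
Proof.
move=> BmBp; case: rg => /=.
  move=> [aS bS _]; have [Ma aM] := Ck_on_bounded_Ck (aS m).
  by have [Mb bM] := Ck_on_bounded_Ck (bS m); exists Ma, Mb.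
move=> [a0 [b0 [_ _ _ abE]]]; exists `|a0|, `|b0|; split.
  by apply: bounded_Ck_ext (bounded_Ck_cst BmBp m a0) => // x /abE[].
by apply: bounded_Ck_ext (bounded_Ck_cst BmBp m b0) => // x /abE[].
Qed.

Section ErrorEstimate.
Variables (R : realType) (P : nat) (xi w : 'I_P.+1 -> R) (rg : regime) (Bm Bp T : R).
Variables (a b : R -> R) (u : R -> R -> R).
Let X : set R := `[Bm, Bp]%classic.
Let I : set R := `[0, T]%classic.
Hypothesis gll : is_gll xi w.
Hypothesis BmBp : Bm < Bp.
Hypothesis T_gt0 : 0 < T.
Hypothesis ab_hyp : coeff_hyp rg X a b.
Hypothesis uC : Ck2_on X I P.+3 u.
Hypothesis u_pde : pde_solution X I a b u.
Hypothesis u_bc : boundary_cond rg Bm Bp I a b u.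

Let exact_residual n s : 'cV[R]_(gsize n.+1 P) :=
  semidiscrete_residual xi w Bm Bp rg a b (nodal xi Bm Bp n.+1 (u^~ s))
    (nodal xi Bm Bp n.+1 ((ddt I u)^~ s))
    (nodal xi Bm Bp n.+1 ((ddt I (ddt I u))^~ s)
     - nodal_diag xi Bm Bp n.+1 a *m Gmx rg xi w Bm Bp n.+1
       *m nodal xi Bm Bp n.+1 ((ddt I u)^~ s)).

(** The equation in terms of space derivatives of time slices, as the truncation estimate needs it;
    this exchanges [u_xt] with [u_tx]. *)
Lemma pde_flux x s : X x -> I s ->
  ddt I (ddt I u) x s - a x * deriv_on X ((ddt I u)^~ s) x =
  deriv_on X (fun y => a y * (ddt I u y s - a y * deriv_on X (u^~ s) y)
                       + b y * deriv_on X (u^~ s) y) x.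
Proof.
move=> Xx Is; have /eqP := u_pde Xx Is; rewrite subr_eq0 => /eqP pdeE.
apply: etrans _ pdeE; apply/esym.
have utC := Ck2_on_ddt uC; have uxC := Ck2_on_ddx uC.
have [_ dtt] := Ck2_on_is_deriv utC Xx Is; have [_ dxt] := Ck2_on_is_deriv uxC Xx Is.
apply: etrans (is_deriv_on_itvE T_gt0 Is (is_deriv_onB dtt (is_deriv_onZ (k := a x) dxt))) _.
by rewrite (ddt_ddxC BmBp T_gt0 (Ck2_on_leq _ uC) Xx Is).
Qed.

Lemma exact_residual_bound : exists2 C : R, 0 <= C & forall n s, I s ->
  entries_le (exact_residual n s) (C * mesh_size Bm Bp n.+1 ^+ P.-1).
Proof.
have [Ma [Mb [aC bC]]] := coeff_bounded P.+1 BmBp ab_hyp.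
have [Mf fC] := Ck2_on_bounded_Ck (Ck2_on_leq (leqW (leqnSn P.+1)) uC).
have [Mx xC] := Ck2_on_bounded_Ck (Ck2_on_leq (leqnSn P.+1) (Ck2_on_ddx uC)).
have [Mg gC] := Ck2_on_bounded_Ck (Ck2_on_leq (leqnSn P.+1) (Ck2_on_ddt uC)).
have [Mphi phiC] : exists Mphi : R, forall s, I s -> bounded_Ck X P.+1 Mphi
    (fun y => a y * (ddt I u y s - a y * deriv_on X (u^~ s) y) + b y * deriv_on X (u^~ s) y).
  (* The constant is assembled by the sum and product rules and does not involve [s]; subtraction is
     multiplication by [-1]. *)
  eexists => s Is; apply: bounded_Ck_ext; last first.
  - apply: (bounded_CkD BmBp); last exact: (bounded_CkM BmBp bC (xC s Is)).
    apply: (bounded_CkM BmBp aC).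
    apply: (bounded_CkD BmBp (gC s Is)).
    apply: (bounded_CkM BmBp (bounded_Ck_cst BmBp P.+1 (-1))).
    exact: (bounded_CkM BmBp aC (xC s Is)).
  - by move=> y _ /=; rewrite /ddx; ring.
  - exact: BmBp.
have XBm : X Bm by rewrite /X /= in_itv /= lexx ltW.
have XBp : X Bp by rewrite /X /= in_itv /= lexx ltW.
have bound n s : I s -> entries_le (exact_residual n s)
    (truncation_const xi w Bm Bp Ma Mb Mf Mg Mphi * mesh_size Bm Bp n.+1 ^+ P.-1).
  move=> Is; apply: (truncation_bound gll BmBp).
  - by move=> x Xx; exact: bounded_Ck_sup aC Xx.
  - move=> x Xx; have b0 := (coeff_ge0 ab_hyp Xx).1; rewrite b0 /=.
    by apply: le_trans (bounded_Ck_sup bC Xx); exact: ler_norm.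
  - exact: fC.
  - exact: gC.
  - exact: phiC.
  - by move=> x Xx; exact: pde_flux.
  have bc := u_bc Is; move: u_bc bc; rewrite /boundary_cond; case: (rg) => /= u_bc' bc.
    by case: bc => /eqP + /eqP; rewrite !subr_eq0 => /eqP ? /eqP.
  case: bc => f0 fx0; split => //.
  (* The condition [u = 0] at [Bp] holds at all times, so [u_t] vanishes there too. *)
  have [_ dt] := Ck2_on_is_deriv uC XBp Is.
  have dt0 : is_deriv_on I (u Bp) s 0.
    apply: is_deriv_on_ext (is_deriv_on_cst I s 0) => // r Ir.
    by have [->] := u_bc' r Ir.
  by rewrite -(is_deriv_on_itvE T_gt0 Is dt) (is_deriv_on_itvE T_gt0 Is dt0).
exists `|truncation_const xi w Bm Bp Ma Mb Mf Mg Mphi| => // n s Is.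
apply: entries_le_trans (bound n s Is).
by rewrite ler_wpM2r ?exprn_ge0 ?(ltW (mesh_gt0 n BmBp))// ler_norm.
Qed.

Lemma exact_residual_eq0 n t : 0 < t -> t <= T ->
  (forall x s, X x -> `[0, t]%classic s -> u x s = 0) ->
  forall s, `[0, t]%classic s -> exact_residual n s = 0.
Proof.
move=> t0 tT u0 s st.
have sub : `[0, t]%classic `<=` I.
  by move=> r /=; rewrite /I /= !in_itv /= => /andP[? ?]; apply/andP; split; lra.
have vanish (v : R -> R -> R) m : Ck2_on X I m.+1 v ->
    (forall x r, X x -> `[0, t]%classic r -> v x r = 0) ->
    forall x r, X x -> `[0, t]%classic r -> ddt I v x r = 0.
  move=> vC v0 x r Xx rt; have [_ dv] := Ck2_on_is_deriv vC Xx (sub _ rt).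
  (* At [r = t] the derivative relative to [[0, T]] also sees later times; since it exists, it
     agrees with the one relative to [[0, t]], which is zero. *)
  rewrite -(is_deriv_on_itvE t0 rt (is_deriv_on_sub sub dv)).
  apply: (is_deriv_on_itvE t0 rt).
  by apply: is_deriv_on_ext (is_deriv_on_cst _ r 0) => // q qt; rewrite v0.
have ut0 := vanish _ _ uC u0; have utt0 := vanish _ _ (Ck2_on_ddt uC) ut0.
have nodal0 (v : R -> R -> R) : (forall x r, X x -> `[0, t]%classic r -> v x r = 0) ->
    nodal xi Bm Bp n.+1 (v^~ s) = 0.
  move=> v0; apply/colP => i; have [k [j ->]] := gidxP i.
  by rewrite nodal_entry mxE v0//; exact: (node_itv gll BmBp).
rewrite /exact_residual !nodal0// /semidiscrete_residual.
by case: (rg); rewrite !(mulmx0, subr0, addr0, scaler0, oppr0).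
Qed.

(** By linearity the residual of the error is that of the exact solution, as the numerical solution
    has none. *)
Lemma energy_error_bound (t e : R) n (U : R -> 'cV[R]_(gsize n.+1 P)) :
  0 < t -> t <= T ->
  semidiscrete_solution rg xi w Bm Bp T a b u U ->
  (forall s, `[0, t]%classic s -> entries_le (exact_residual n s) e) ->
  energy_error rg xi w Bm Bp T a b u U t <=
  2 * t * Num.sqrt ((Bp - Bm) / 2 * (\sum_j w j)) * e.
Proof.
move=> t0 tT [U0 V0 Ud Ueq] res.
have sub : `[0, t]%classic `<=` I.
  by move=> r /=; rewrite /I /= !in_itv /= => /andP[? ?]; apply/andP; split; lra.
pose Ux s := nodal xi Bm Bp n.+1 (u^~ s).
pose Vx s := nodal xi Bm Bp n.+1 ((ddt I u)^~ s).
pose Zx s := nodal xi Bm Bp n.+1 ((ddt I (ddt I u))^~ s).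
pose M := nodal_diag xi Bm Bp n.+1 a *m Gmx rg xi w Bm Bp n.+1.
pose E s := Ux s - U s.
pose V s := Vx s - vderiv_on I U s.
pose Wd s := Zx s - M *m Vx s - vderiv_on I (Wvec rg xi w Bm Bp I a U) s.
have Uxd s : I s -> forall i, is_deriv_on I (fun r => Ux r i 0) s (Vx s i 0).
  move=> Is i; have [k [j ->]] := gidxP i; rewrite /Ux /Vx nodal_entry.
  under eq_fun do rewrite nodal_entry.
  by have [] := Ck2_on_is_deriv uC (node_itv gll BmBp k j) Is.
have Vxd s : I s -> forall i, is_deriv_on I (fun r => Vx r i 0) s (Zx s i 0).
  move=> Is i; have [k [j ->]] := gidxP i; rewrite /Vx /Zx nodal_entry.
  under eq_fun do rewrite nodal_entry.
  by have [] := Ck2_on_is_deriv (Ck2_on_ddt uC) (node_itv gll BmBp k j) Is.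
have Ed s : I s -> forall i, is_deriv_on I (fun r => E r i 0) s (V s i 0).
  move=> Is i; rewrite !v_entry.
  have [Usd _] := Ud s Is.
  have := is_deriv_onB (Uxd s Is i) (derivable_onP (Usd i)).
  rewrite [vderiv_on _ _ _ _ _]mxE.
  by apply: is_deriv_on_ext => // r _; rewrite !v_entry.
have EWd s : I s -> forall i, is_deriv_on I (fun r => (V r - M *m E r) i 0) s (Wd s i 0).
  move=> Is i; have [_ Wsd] := Ud s Is.
  have := is_deriv_onB (is_deriv_onB (Vxd s Is i) (is_deriv_on_mulmx (M := M) (Uxd s Is) (i := i)))
    (derivable_onP (Wsd i)).
  rewrite !v_entry [vderiv_on _ _ _ _ _]mxE.
  apply: is_deriv_on_ext => // r _; rewrite /V /E mulmxBr /Wvec -/M !v_entry.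
  by ring.
have IT : `[0, t]%classic t by rewrite /= in_itv /= lexx ltW.
have I0 : I 0 by rewrite /I /= in_itv /= lexx ltW.
have resE s : `[0, t]%classic s ->
    entries_le (semidiscrete_residual xi w Bm Bp rg a b (E s) (V s) (Wd s)) e.
  move=> st; rewrite /E /V /Wd semidiscrete_residualB.
  have -> : semidiscrete_residual xi w Bm Bp rg a b (U s) (vderiv_on I U s)
      (vderiv_on I (Wvec rg xi w Bm Bp I a U) s) = 0.
    by apply/eqP; rewrite subr_eq0; apply/eqP; exact: (Ueq s (sub s st)).
  by rewrite subr0; exact: res.
have E0 : E 0 = 0 by rewrite /E U0 subrr.
have VV0 : V 0 = 0 by rewrite /V V0 subrr.
have := energy_bound gll BmBp ab_hyp t0 (fun s st i => is_deriv_on_sub sub (Ed s (sub s st) i))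
  (fun s st i => is_deriv_on_sub sub (EWd s (sub s st) i)) E0 VV0 resE.
apply: le_trans; rewrite /energy_error /energy /energy_velocity.
have -> : vderiv_on I (fun s => nodal xi Bm Bp n.+1 (u^~ s) - U s) t = V t.
  apply/colP => i; rewrite mxE.
  exact: is_deriv_on_itvE T_gt0 (sub _ IT) (Ed _ (sub _ IT) i).
rewrite HgE -/(Ux t) -/(E t).
by case: (rg) => /=; rewrite wprodE quadratic_formE.
Qed.

End ErrorEstimate.

Theorem theorem15 (R : realType) (P : nat) (hP : (1 <= P)%N) :
  exists2 m : nat, (P.+1 <= m)%N &
  forall (xi w : 'I_P.+1 -> R) (rg : regime) (Bm Bp T : R) (a b : R -> R)
         (u : R -> R -> R),
    is_gll xi w ->
    Bm < Bp -> 0 < T ->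
    coeff_hyp rg `[Bm, Bp] a b ->
    Ck2_on `[Bm, Bp] `[0, T] m u ->
    pde_solution `[Bm, Bp] `[0, T] a b u ->
    boundary_cond rg Bm Bp `[0, T] a b u ->
    forall t : R, 0 < t -> t <= T ->
    exists2 C : R, 0 < C &
    forall (K : nat) (U : R -> 'cV[R]_(\sum_(k < K) P.+1)),
      (2 <= K)%N ->
      semidiscrete_solution rg xi w Bm Bp T a b u U ->
      energy_error rg xi w Bm Bp T a b u U t
      <= C * mesh_size Bm Bp K ^+ P.-1
         * Rintegral lebesgue_measure `[0, t]
             (fun tau => sobolev_norm `[Bm, Bp] P.+1 (u^~ tau)).
Proof.
exists P.+3; first by rewrite (leq_trans (leqnSn _)).
move=> xi w rg Bm Bp T a b u gll BmBp T0 ab_hyp uC u_pde u_bc t t0 tT.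
set J := Rintegral _ _ _.
pose S := 2 * t * Num.sqrt ((Bp - Bm) / 2 * (\sum_j w j)).
have S0 : 0 <= S by rewrite mulr_ge0 ?sqrtr_ge0// mulr_ge0// ltW.
have [J0|J0] := leP J 0.
  exists 1 => // -[//|n] U _ sol.
  have -> : J = 0.
    by apply/eqP; rewrite eq_le J0 Rintegral_ge0// => s _; exact: sqrtr_ge0.
  have u0 := sobolev_integral_eq0 BmBp (Ck2_on_leq (leqnSn _) uC) t0 tT J0.
  rewrite mulr0 -(mulr0 S).
  apply: (energy_error_bound gll BmBp T0 ab_hyp uC t0 tT sol) => s st.
  by rewrite (exact_residual_eq0 rg a b gll BmBp uC _ t0 tT u0 st) => i; rewrite mxE normr0.
have [C C0 res] := exact_residual_bound gll BmBp T0 ab_hyp uC u_pde u_bc.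
(* Division by [J] lets the integral cancel; adding 1 keeps the constant positive when [S * C] is
   zero. *)
exists ((S * C + 1) / J); first by rewrite divr_gt0// ltr_wpDl// mulr_ge0.
move=> [//|n] U _ sol.
have sub s : `[0, t]%classic s -> `[0, T]%classic s.
  by rewrite /= !in_itv /= => /andP[? ?]; apply/andP; split; lra.
have := energy_error_bound gll BmBp T0 ab_hyp uC t0 tT sol (fun s st => res n s (sub s st)).
move=> h; apply: le_trans h _.
have -> : (S * C + 1) / J * mesh_size Bm Bp n.+1 ^+ P.-1 * J =
    (S * C + 1) * mesh_size Bm Bp n.+1 ^+ P.-1 by field; rewrite gt_eqF.
by rewrite mulrA ler_wpM2r ?exprn_ge0 ?(ltW (mesh_gt0 n BmBp))// lerDl.
Qed.
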